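(* Let $\delta \in (0,1)$ and $\epsilon \in (0,1)$. Let $A \in \mathbb{R}^{N \times N}$ be any (symmetric) positive-semidefinite matrix and let $\mu > 0$. Let $r$ be a nonnegative integer satisfying $$ r \;\geq\; \operatorname{rank}_\mu(A)\,\bigl(1 + \log(\operatorname{tr} A/\mu)\bigr), $$ and let $\hat{A}$ be the random approximation of $A$ produced by the randomly pivoted Cholesky algorithm (RPCholesky) with block size $1$ and approximation rank $r$. Set $P = \hat{A} + \mu I$. Then, with probability at least $1-\delta$ over the random pivots, $$ \kappa\bigl(P^{-1/2}(A+\mu I)P^{-1/2}\bigr) \leq 3/\delta. \qquad (\ast)$$ Moreover, whenever the event $(\ast)$ occurs, the following holds for every $y \in \mathbb{R}^N$. Let $\beta = (A+\mu I)^{-1}y$, and let $\beta^{(t)}$ be the $t$-th iterate of the conjugate gradient method with preconditioner $P$ and zero initial iterate, applied to the linear system $(A+\mu I)\beta = y$. Then $$ \lVert \beta^{(t)} - \beta\rVert_{A+\mu I} \leq \epsilon\, \lVert \beta \rVert_{A+\mu I} $$ for every iteration $t \geq \delta^{-1/2}\log(2/\epsilon)$.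
   Context: Notation. $\log$ is the natural logarithm. $\lambda_i(A)$ is the $i$-th largest eigenvalue of $A$. $\kappa(M) = \lVert M\rVert\,\lVert M^{-1}\rVert$ is the condition number in the spectral norm. For positive-definite $M$, $\lVert z\rVert_M = (z^* M z)^{1/2}$, where $^*$ denotes transpose. Tail rank. For a positive-semidefinite $A\in\mathbb{R}^{N\times N}$ and $\mu>0$, $$\operatorname{rank}_\mu(A) = \min\Bigl\{ r \ge 0 : \sum_{i>r}\lambda_i(A) \le \mu \Bigr\}.$$ When $\operatorname{rank}_\mu(A)=0$, the lower bound on $r$ is read as $r \ge 0$. RPCholesky with block size $1$ and approximation rank $r$. Start with the residual $R_0 = A$. For $i = 1,\dots,r$: if $\operatorname{tr} R_{i-1} = 0$, set $R_i = R_{i-1}$ (the residual is zero and the approximation is exact). Otherwise, conditionally on the previous pivots, sample a random pivot $s_i \in \{1,\dots,N\}$ with $\mathbb{P}\{s_i = s\} = R_{i-1}(s,s)/\operatorname{tr}(R_{i-1})$, and set $$R_i = R_{i-1} - \frac{R_{i-1}(:,s_i)\,R_{i-1}(s_i,:)}{R_{i-1}(s_i,s_i)}.$$ The output is $\hat{A} = A - R_r$, a positive-semidefinite matrix of rank at most $r$ (equivalently, the column Nyström approximation $\hat{A} = A(:,S)A(S,S)^\dagger A(S,:)$, where $S$ is the set of selected pivots and $^\dagger$ is the Moore–Penrose pseudoinverse). Preconditioned conjugate gradient (PCG). For a system $Mz=b$ with $M$ positive definite and a positive-definite preconditioner $P$, PCG with zero initial iterate is equivalent to conjugate gradient applied to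 the matrix $P^{-1/2}MP^{-1/2}$. Its $t$-th iterate $z^{(t)}$ is the unique minimizer of $\lVert w - z\rVert_M$ over $w$ in the Krylov subspace $\operatorname{span}\{(P^{-1}M)^j P^{-1}b : 0\le j\le t-1\}$, where $z=M^{-1}b$ (in exact arithmetic; $z^{(0)}=0$, and once the exact solution is reached the iterates remain there). *)

(* Defs.v *)
From mathcomp Require Import all_boot all_order all_algebra.
From mathcomp Require Import all_classical all_reals all_analysis.

Set Implicit Arguments.
Unset Strict Implicit.
Unset Printing Implicit Defensive.

Import Order.TTheory GRing.Theory Num.Theory.
Local Open Scope classical_set_scope.
Local Open Scope ring_scope.

Section LinearAlgebra.
Context {R : realType} {N : nat}.
Implicit Types (A M P S : 'M[R]_N) (b u v w : 'cV[R]_N).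

Definition psdmx A : Prop :=
  A^T = A /\ forall v, 0 <= (v^T *m A *m v) 0 0.

(* The eigenvalues of A in nonincreasing order, repeated according to
   multiplicity.  The sequence is unique, and it exists for symmetric A.
   Indices start at 0: the i-th largest eigenvalue is (eigvals A)`_i.-1. *)
Definition eigvals A : seq R :=
  xget [::] [set s : seq R | sorted >=%R s /\
                             char_poly A = \prod_(a <- s) ('X - a%:P)].

(* For mu >= 0 the empty tail, at k = N, always qualifies, so minimizing over
   k <= N is the same as minimizing over all natural numbers k. *)
Definition tail_rank (mu : R) A : nat :=
  [arg min_(k < (ord_max : 'I_N.+1) |
      (\sum_(k <= i < N) (eigvals A)`_i <= mu)%R) (k : nat)]%N.

(* For positive-definite M. *)
Definition energy_norm M v : R := Num.sqrt ((v^T *m M *m v) 0 0).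

Definition spectral_norm M : R :=
  sup [set energy_norm 1%:M (M *m v) | v in [set v | energy_norm 1%:M v <= 1]].

Definition condition_number M : R := spectral_norm M * spectral_norm (invmx M).

(* The positive-semidefinite square root; it exists and is unique for
   positive-semidefinite P. *)
Definition sqrtmx P : 'M[R]_N := xget 0 [set S | psdmx S /\ S *m S = P].

Definition krylov M P b (t : nat) : {vspace 'cV[R]_N} :=
  <<[seq (invmx P *m M) ^+ j *m (invmx P *m b) | j <- iota 0 t]>>%VS.

(* The t-th iterate of preconditioned conjugate gradient for M z = b, with zero
   initial iterate, in exact arithmetic.  The minimizer exists and is unique
   for positive-definite M. *)
Definition pcg_iterate M P b (t : nat) : 'cV[R]_N :=
  xget 0 [set w | w \in krylov M P b t /\
    forall u, u \in krylov M P b t ->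
      energy_norm M (w - invmx M *m b) <= energy_norm M (u - invmx M *m b)].

(* Pivots are numbered from 0: residual A h i is R_i for the pivots
   h 0, ..., h i.-1, and h i is ignored once the residual has zero trace. *)
Fixpoint residual A (h : nat -> 'I_N) (i : nat) : 'M[R]_N :=
  if i is j.+1 then
    let Rj := residual A h j in
    if \tr Rj == 0 then Rj
    else Rj - (Rj (h j) (h j))^-1 *: (col (h j) Rj *m row (h j) Rj)
  else A.

Definition rpcholesky A (h : nat -> 'I_N) (r : nat) : 'M[R]_N :=
  A - residual A h r.

End LinearAlgebra.

(* s 0, ..., s r.-1 are random pivots with the conditional law prescribed by
   RPCholesky.  The conditional probabilities given the previous pivots are
   written in product form, so that nothing is divided by the probability of
   the history.  The value of s i is unconstrained when the residual has zero
   trace, since no pivot is drawn there and residual does not use it. *)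
Definition rpcholesky_pivots {R : realType} {d : measure_display}
    {T : measurableType d} (Pr : probability T R) {N : nat} (A : 'M[R]_N)
    (r : nat) (s : nat -> T -> 'I_N) : Prop :=
  (forall i p, (i < r)%N -> measurable (s i @^-1` [set p])) /\
  forall i (h : nat -> 'I_N) p, (i < r)%N ->
    let Ri := residual A h i in
    let history := [set w | forall j, (j < i)%N -> s j w = h j] in
    \tr Ri != 0 ->
    Pr (history `&` s i @^-1` [set p]) =
      (Pr history * (Ri p p / \tr Ri)%:E)%E.

(* Main.v *)
(* Let k be the tail rank and Q the spectral projector of A onto its k largest
   eigenvalues.  Residuals R are dominated by A, so tr ((1 - Q) R) <= mu, and the
   Cauchy-Schwarz inequality tr (R Q R) >= (tr (Q R))^2 / k turns one step of
   RPCholesky into E tr (Q R') <= f (tr (Q R)) with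
   f a = a - a^2 / (k (a + mu)), which is concave and nondecreasing.  By Jensen,
   E tr R_r <= f^r (tr (Q A)) + mu, and comparison with the differential equation
   x' = - x^2 / (k (x + mu)) gives f^r (tr (Q A)) <= mu.  Markov's inequality then
   yields tr R_r < 2 mu / delta with probability at least 1 - delta, in which case
   P <= A + mu I <= (1 + tr R_r / mu) P bounds the condition number by 3 / delta.
   The convergence rate is the Chebyshev bound
   2 ((sqrt K - 1) / (sqrt K + 1))^t for K = 3 / delta, together with
   (1 - x) / (1 + x) <= exp (- 2 x). *)

Require Import Defs.
From mathcomp Require Import all_boot all_order all_algebra.
From mathcomp Require Import all_classical all_reals all_analysis.
From mathcomp Require Import perm complex ring lra.

Set Implicit Arguments.
Unset Strict Implicit.
Unset Printing Implicit Defensive.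

Import Order.TTheory GRing.Theory Num.Theory.
Local Open Scope classical_set_scope.
Local Open Scope ring_scope.

(** * Real symmetric matrices *)

Section BilinearForm.
Context {R : comNzRingType} {n : nat}.
Implicit Types (M B C : 'M[R]_n) (u v w : 'cV[R]_n).

Definition bform M u v : R := (u^T *m M *m v) 0 0.

Lemma bformDl M u v w : bform M (u + v) w = bform M u w + bform M v w.
Proof. by rewrite /bform linearD /= !mulmxDl mxE. Qed.

Lemma bformDr M u v w : bform M w (u + v) = bform M w u + bform M w v.
Proof. by rewrite /bform mulmxDr mxE. Qed.

Lemma bformZl M a u w : bform M (a *: u) w = a * bform M u w.
Proof. by rewrite /bform linearZ /= -!scalemxAl mxE. Qed.

Lemma bformZr M a u w : bform M w (a *: u) = a * bform M w u.
Proof. by rewrite /bform -scalemxAr mxE. Qed.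

Lemma bformNl M u w : bform M (- u) w = - bform M u w.
Proof. by rewrite -scaleN1r bformZl mulN1r. Qed.

Lemma bformNr M u w : bform M w (- u) = - bform M w u.
Proof. by rewrite -scaleN1r bformZr mulN1r. Qed.

Lemma bform0l M w : bform M 0 w = 0.
Proof. by rewrite -(scale0r 0) bformZl mul0r. Qed.

Lemma bform0r M w : bform M w 0 = 0.
Proof. by rewrite -(scale0r 0) bformZr mul0r. Qed.

Definition bformE :=
  (bformDl, bformDr, bformNl, bformNr, bformZl, bformZr, bform0l, bform0r).

Lemma bformDm M B u v : bform (M + B) u v = bform M u v + bform B u v.
Proof. by rewrite /bform mulmxDr mulmxDl mxE. Qed.

Lemma bformZm M a u v : bform (a *: M) u v = a * bform M u v.
Proof. by rewrite /bform -scalemxAr -scalemxAl mxE. Qed.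

Lemma bformNm M u v : bform (- M) u v = - bform M u v.
Proof. by rewrite -scaleN1r bformZm mulN1r. Qed.

Lemma bform_scalar a u v : bform a%:M u v = a * bform 1%:M u v.
Proof. by rewrite -[a%:M]scalemx1 bformZm. Qed.

Lemma bformC M u v : M^T = M -> bform M u v = bform M v u.
Proof.
move=> symM; rewrite /bform -[in LHS](trmxK (u^T *m M *m v)) mxE.
by rewrite !trmx_mul trmxK symM mulmxA.
Qed.

Lemma bform_mulmx B C M u v :
  bform M (B *m u) (C *m v) = bform (B^T *m M *m C) u v.
Proof. by rewrite /bform trmx_mul !mulmxA. Qed.

Lemma bform_mulr M C u v : bform M u (C *m v) = bform (M *m C) u v.
Proof. by rewrite /bform !mulmxA. Qed.

Lemma bform_delta M i j : bform M (delta_mx i 0) (delta_mx j 0) = M i j.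
Proof. by rewrite /bform trmx_delta -rowE -colE !mxE. Qed.

Lemma bform_diag (d : 'rV[R]_n) u :
  bform (diag_mx d) u u = \sum_i d 0 i * u i 0 ^+ 2.
Proof.
rewrite /bform mul_mx_diag mxE; apply: eq_bigr => i _; rewrite !mxE; ring.
Qed.

Lemma bform1 u : bform 1%:M u u = \sum_i u i 0 ^+ 2.
Proof.
by rewrite /bform mulmx1 mxE; apply: eq_bigr => i _; rewrite mxE expr2.
Qed.

End BilinearForm.

Lemma bform1_ge0 {R : realDomainType} {n} (u : 'cV[R]_n) : 0 <= bform 1%:M u u.
Proof. by rewrite bform1 sumr_ge0 // => i _; rewrite sqr_ge0. Qed.

Lemma bform1_eq0 {R : realDomainType} {n} (u : 'cV[R]_n) :
  (bform 1%:M u u == 0) = (u == 0).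
Proof.
apply/eqP/eqP => [|->]; last exact: bform0l.
rewrite bform1 => /eqP; rewrite psumr_eq0 => [/allP h|j _]; last exact: sqr_ge0.
apply/colP => j; have := h j (mem_index_enum j).
by rewrite /= sqrf_eq0 => /eqP ->; rewrite mxE.
Qed.

(** Over the complexification there is an eigenvector [w = x + i y] with eigenvalue [z]. Symmetry
    gives [Im z * (|x|^2 + |y|^2) = 0], so [z] is real and [x] or [y] is a real eigenvector. *)
Lemma symmetric_eigenvector (R : rcfType) n (A : 'M[R]_n.+1) :
  A^T = A -> exists a (v : 'cV[R]_n.+1), v != 0 /\ A *m v = a *: v.
Proof.
move=> symA.
have symE i j : A i j = A j i by rewrite -[in LHS]symA mxE.
have [z /eigenvalueP[w wA w0]] :=
  eigenvalue_closed (map_mx (real_complex R) A) (ltn0Sn n).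
pose x := \col_j complex.Re (w 0 j); pose y := \col_j complex.Im (w 0 j).
have ReIm j : complex.Re ((w *m map_mx (real_complex R) A) 0 j) = (A *m x) j 0 /\
    complex.Im ((w *m map_mx (real_complex R) A) 0 j) = (A *m y) j 0.
  rewrite !mxE !raddf_sum /=; split; apply: eq_bigr => i _; rewrite !mxE (symE j);
  case: (w 0 i) => a b /=; ring.
have Ax : A *m x = complex.Re z *: x - complex.Im z *: y.
  apply/colP => j; rewrite -(ReIm j).1 wA !mxE.
  by case: z {wA} => a b; case: (w 0 j) => c d /=.
have Ay : A *m y = complex.Re z *: y + complex.Im z *: x.
  apply/colP => j; rewrite -(ReIm j).2 wA !mxE.
  case: z {wA Ax} => a b; case: (w 0 j) => c d /=; ring.
have xy0 : x = 0 -> y = 0 -> w = 0.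
  move=> /colP x0 /colP y0; apply/rowP => j.
  by move: (x0 j) (y0 j); rewrite !mxE; case: (w 0 j) => a b /= -> ->.
have : bform 1%:M y (A *m x) = bform 1%:M x (A *m y).
  by rewrite !bform_mulr !mul1mx bformC.
rewrite Ax Ay !bformE (bformC y x (trmx1 _ _)) => h.
have : complex.Im z * (bform 1%:M x x + bform 1%:M y y) = 0 by lra.
move/eqP; rewrite mulf_eq0 => /orP[/eqP Imz|]; last first.
  rewrite paddr_eq0 ?bform1_ge0 // !bform1_eq0 => /andP[/eqP x0 /eqP y0].
  by rewrite (xy0 x0 y0) eqxx in w0.
move: Ax Ay; rewrite Imz !scale0r subr0 addr0 => Ax Ay.
have [x0|x0] := eqVneq x 0; last by exists (complex.Re z), x.
exists (complex.Re z), y; split => //; apply: contraNneq w0 => y0.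
by rewrite xy0.
Qed.

(* The Householder reflection exchanging e_0 and v. *)
Lemma reflection_to_unit (R : realFieldType) n (v : 'cV[R]_n.+1) :
  bform 1%:M v v = 1 ->
  exists H : 'M[R]_n.+1, [/\ H^T = H, H *m H = 1%:M & H *m delta_mx 0 0 = v].
Proof.
move=> v1; pose e : 'cV[R]_n.+1 := delta_mx 0 0; pose u := e - v.
pose c := 2 / bform 1%:M u u.
have e1 : bform 1%:M e e = 1 by rewrite bform_delta mxE.
have uu : bform 1%:M u u = 2 * bform 1%:M u e.
  rewrite /u !bformE e1 v1 (bformC v e (trmx1 _ _)); ring.
have uuE w : u *m u^T *m w = bform 1%:M u w *: u.
  by rewrite -mulmxA [u^T *m w]mx11_scalar mul_mx_scalar /bform mulmx1.
(* When [v] is already e_0, [u = 0] and [c = 2 / 0 = 0], so the reflection degenerates to the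
   identity. *)
exists (1%:M - c *: (u *m u^T)); split.
- by rewrite linearB /= trmx1 linearZ /= trmx_mul trmxK.
- rewrite mulmxBl mul1mx mulmxBr mulmx1 -scalemxAl -scalemxAr scalerA.
  rewrite mulmxA uuE -scalemxAl scalerA -scalerBl -addrA -opprD -scalerDl.
  have [uu0|uu0] := eqVneq (bform 1%:M u u) 0.
    by move/eqP: uu0; rewrite bform1_eq0 => /eqP ->; rewrite mul0mx scaler0 subr0.
  suff -> : c + (c - c * c * bform 1%:M u u) = 0 by rewrite scale0r subr0.
  by rewrite /c; field.
- rewrite mulmxBl mul1mx -scalemxAl uuE scalerA.
  have [uu0|uu0] := eqVneq (bform 1%:M u u) 0.
    move/eqP: uu0; rewrite bform1_eq0 => /eqP u0.
    by rewrite u0 scaler0 subr0; apply/eqP; rewrite -subr_eq0 -/e -/u u0.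
  have -> : c * bform 1%:M u (delta_mx 0 0) = 1.
    rewrite /c uu -/e; field; move: uu0; rewrite uu mulf_eq0 negb_or.
    by case/andP.
  by rewrite scale1r /u -/e subKr.
Qed.

(** Induction by deflation: a reflection [H] taking e_0 to a unit eigenvector makes [H A H] block
    diagonal, with the eigenvalue as its 1 by 1 corner. *)
Lemma symmetric_diagonalization (R : rcfType) n (A : 'M[R]_n) :
  A^T = A ->
  exists (U : 'M[R]_n) (d : 'rV[R]_n),
    U^T *m U = 1%:M /\ A = U^T *m diag_mx d *m U.
Proof.
elim: n A => [|n IHn] A symA.
  by exists 1%:M, 0; split; apply/matrixP => -[].
have [a [v0 [v0_neq0 Av0]]] := symmetric_eigenvector symA.
have q_gt0 : 0 < bform 1%:M v0 v0 by rewrite lt_def bform1_eq0 v0_neq0 bform1_ge0.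
pose v := (Num.sqrt (bform 1%:M v0 v0))^-1 *: v0.
have v1 : bform 1%:M v v = 1.
  rewrite !bformE mulrA -invfM -expr2 sqr_sqrtr ?ltW // mulVf //.
  by rewrite gt_eqF.
have Av : A *m v = a *: v by rewrite -scalemxAr Av0 !scalerA mulrC.
have [H [symH HH He]] := reflection_to_unit v1.
have [B BE0] : exists B, B = H *m A *m H by exists (H *m A *m H).
have symB : B^T = B by rewrite BE0 !trmx_mul symH symA mulmxA.
have Be : B *m delta_mx 0 0 = a *: delta_mx 0 0 :> 'cV[R]_n.+1.
  by rewrite BE0 -!mulmxA He Av -scalemxAr -He mulmxA HH mul1mx.
have B0 j : B j 0 = a * (j == 0)%:R.
  have := congr1 (fun w : 'cV[R]_n.+1 => w j 0) Be.
  by rewrite -colE !mxE eqxx andbT.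
have BE : (B : 'M[R]_(1 + n)) = block_mx a%:M 0 0 (drsubmx (B : 'M[R]_(1 + n))).
  rewrite -[LHS](@submxK _ 1 n 1 n); congr block_mx; apply/matrixP => i j; rewrite !mxE.
  - by rewrite !ord1 !lshift0 B0 mulr1.
  - by rewrite -symB mxE !ord1 !lshift0 B0 mulr0.
  - by rewrite !ord1 !lshift0 B0 mulr0.
have symB' : (drsubmx (B : 'M[R]_(1 + n)))^T = drsubmx (B : 'M[R]_(1 + n)).
  by apply/matrixP => i j; rewrite !mxE -[in LHS]symB mxE.
have [U [d [UU BU]]] := IHn _ symB'.
pose V : 'M[R]_(1 + n) := block_mx 1%:M 0 0 U.
pose D : 'rV[R]_(1 + n) := row_mx a%:M d.
have VV : V^T *m V = 1%:M.
  rewrite /V tr_block_mx trmx1 !trmx0 mulmx_block.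
  rewrite !(mulmx0, mul0mx, mulmx1, addr0, add0r) UU.
  by rewrite -scalar_mx_block.
have VDV : V^T *m diag_mx D *m V = B.
  rewrite /V /D diag_mx_row tr_block_mx trmx1 !trmx0 [RHS]BE BU.
  have -> : diag_mx (a%:M : 'rV[R]_1) = a%:M.
    by apply/matrixP => i j; rewrite !ord1 !mxE.
  rewrite !mulmx_block.
  by rewrite !(mulmx0, mul0mx, mulmx1, mul1mx, addr0, add0r).
exists (V *m H), D; rewrite trmx_mul symH; split.
  by rewrite mulmxA -(mulmxA H) VV mulmx1.
rewrite -!mulmxA (mulmxA (diag_mx D)) (mulmxA V^T) (mulmxA V^T) VDV BE0.
by rewrite -!mulmxA HH mulmx1 mulmxA HH mul1mx.
Qed.

(** * Residuals of the Cholesky process *)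

(** Elimination step of [residual] without its zero-trace test. Since [0^-1 = 0], a zero pivot
    leaves [A] unchanged, and a positive-semidefinite matrix of zero trace is 0; hence
    [residualS]. *)
Definition schur {R : realType} {n} (A : 'M[R]_n) (p : 'I_n) : 'M[R]_n :=
  A - (A p p)^-1 *: (col p A *m row p A).

Section PositiveSemidefinite.
Context {R : realType} {n : nat}.
Implicit Types (A B Q : 'M[R]_n) (u v : 'cV[R]_n) (p q : 'I_n).

Lemma psdmx_sym A i j : psdmx A -> A i j = A j i.
Proof. by move=> [symA _]; rewrite -[in LHS]symA mxE. Qed.

Lemma psdmx_bform A v : psdmx A -> 0 <= bform A v v.
Proof. by move=> [_]; apply. Qed.

Lemma psdmx_diag_ge0 A p : psdmx A -> 0 <= A p p.
Proof. by move=> /psdmx_bform h; rewrite -bform_delta. Qed.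

Lemma psdmx_tr_ge0 A : psdmx A -> 0 <= \tr A.
Proof. by move=> psdA; rewrite sumr_ge0 // => i _; exact: psdmx_diag_ge0. Qed.

Lemma psdmx_diag_eq0 A p q : psdmx A -> A p p = 0 -> A q p = 0.
Proof.
move=> psdA App; apply/eqP/negPn/negP => Aqp.
(* With [A p p = 0] the form at [e_q + t e_p] is affine in [t]; this [t] gives it the value -1. *)
pose t := - (A q q + 1) / (2 * A q p).
have := psdmx_bform (delta_mx q 0 + t *: delta_mx p 0) psdA.
rewrite !bformE !bform_delta App (psdmx_sym p q psdA).
have -> : A q q + t * A q p + (t * A q p + t * (t * 0)) = -1.
  by rewrite /t; field.
by rewrite lerNr oppr0 ler10.
Qed.

Lemma psdmx_tr_eq0 A : psdmx A -> \tr A = 0 -> A = 0.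
Proof.
move=> psdA /eqP.
rewrite psumr_eq0 => [/allP h|i _]; last exact: psdmx_diag_ge0.
apply/matrixP => i j; rewrite mxE; apply: (psdmx_diag_eq0 _ psdA).
by apply/eqP; exact: h (mem_index_enum j).
Qed.

Lemma psdmxD A B : psdmx A -> psdmx B -> psdmx (A + B).
Proof.
move=> psdA psdB; split; first by rewrite linearD /= psdA.1 psdB.1.
by move=> v; rewrite -/(bform _ v v) bformDm addr_ge0 ?psdmx_bform.
Qed.

Lemma psdmx0 : psdmx (0 : 'M[R]_n).
Proof. by split=> [|v]; rewrite ?trmx0 // mulmx0 mul0mx mxE. Qed.

Lemma psdmx_scalar a : 0 <= a -> psdmx (a%:M : 'M[R]_n).
Proof.
move=> a0; split=> [|v]; first exact: tr_scalar_mx.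
by rewrite -/(bform _ v v) bform_scalar mulr_ge0 // bform1_ge0.
Qed.

Lemma psdmx_conj A B : psdmx A -> psdmx (B^T *m A *m B).
Proof.
move=> psdA; split=> [|v]; first by rewrite !trmx_mul trmxK psdA.1 mulmxA.
by rewrite -/(bform _ v v) -bform_mulmx; exact: psdmx_bform.
Qed.

Lemma bform_col_row A p u : psdmx A ->
  bform (col p A *m row p A) u u = bform A u (delta_mx p 0) ^+ 2.
Proof.
move=> psdA; rewrite /bform colE rowE !mulmxA -(mulmxA _ _ u).
rewrite -(mulmxA (u^T *m A *m delta_mx p 0)) [X in X *m _]mx11_scalar.
rewrite mul_scalar_mx mxE expr2; congr (_ * _).
by rewrite -trmx_delta mulmxA -/(bform A (delta_mx p 0) u) bformC //; case: psdA.
Qed.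

Lemma col_row_sym A p : psdmx A -> (col p A *m row p A)^T = col p A *m row p A.
Proof. by move=> [symA _]; rewrite trmx_mul tr_col tr_row symA. Qed.

Lemma psdmx_sub_schur A p : psdmx A -> psdmx (A - schur A p).
Proof.
move=> psdA; rewrite /schur subKr; split.
  by rewrite linearZ /= col_row_sym.
move=> v; rewrite -/(bform _ v v) bformZm bform_col_row //.
by rewrite mulr_ge0 ?sqr_ge0 // invr_ge0 psdmx_diag_ge0.
Qed.

Lemma psdmx_schur A p : psdmx A -> psdmx (schur A p).
Proof.
move=> psdA; split; first by rewrite linearB /= linearZ /= col_row_sym // psdA.1.
move=> v; rewrite -/(bform _ v v) bformDm bformNm bformZm bform_col_row //.
have [App|App] := eqVneq (A p p) 0.
  by rewrite App invr0 mul0r subr0 psdmx_bform.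
(* The form of the Schur complement at [v] is the form of [A] at [v - c e_p], where this [c]
   minimizes the latter. *)
pose c := bform A v (delta_mx p 0) / A p p.
have := psdmx_bform (v - c *: delta_mx p 0) psdA.
rewrite !bformE bform_delta (bformC (delta_mx p 0) v psdA.1).
by congr (_ <= _); rewrite /c; field.
Qed.

Lemma trace_proj_ge0 A Q : psdmx A -> Q^T = Q -> Q *m Q = Q -> 0 <= \tr (Q *m A).
Proof.
move=> psdA symQ QQ; rewrite -QQ -mulmxA mxtrace_mulC.
rewrite -{1}symQ; exact/psdmx_tr_ge0/psdmx_conj.
Qed.

Lemma trace_sqr_ge0 A : 0 <= \tr (A^T *m A).
Proof.
apply: sumr_ge0 => i _; rewrite mxE; apply: sumr_ge0 => j _.
by rewrite mxE -expr2 sqr_ge0.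
Qed.

(** The weight [A p p] of a pivot cancels the [(A p p)^-1] of its Schur complement, leaving the p-th
    diagonal entry of [A Q A]. *)
Lemma expected_schur A Q : psdmx A -> \tr A != 0 ->
  \sum_p A p p / \tr A * \tr (Q *m schur A p)
    = \tr (Q *m A) - \tr (A *m Q *m A) / \tr A.
Proof.
move=> psdA trA.
have trE p : \tr (Q *m (col p A *m row p A)) = (A *m Q *m A) p p.
  rewrite mulmxA mxtrace_mulC [X in \tr X]mx11_scalar mxtrace_scalar mulr1n.
  by rewrite rowE colE -[RHS]bform_delta /bform trmx_delta !mulmxA.
have termE p : A p p / \tr A * \tr (Q *m schur A p) =
    A p p * (\tr (Q *m A) / \tr A) - (A *m Q *m A) p p / \tr A.
  rewrite mulmxBr linearB /= -scalemxAr linearZ /= trE.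
  have [App|App] := eqVneq (A p p) 0; last by field; rewrite App trA.
  (* At a zero pivot nothing cancels, but the p-th column of [A] vanishes. *)
  have -> : (A *m Q *m A) p p = 0.
    rewrite mxE big1 // => j _.
    by rewrite (psdmx_diag_eq0 _ psdA App) mulr0.
  by rewrite App !mul0r subr0.
rewrite (eq_bigr _ (fun p _ => termE p)) sumrB -!mulr_suml.
by rewrite -/(\tr A) -/(\tr (A *m Q *m A)); field.
Qed.

(* Expanding tr (Z^T Z) >= 0 for Z = Q A - (tr (Q A) / tr Q) Q. *)
Lemma trace_proj_sqr A Q : psdmx A -> Q^T = Q -> Q *m Q = Q ->
  \tr (Q *m A) ^+ 2 / \tr Q <= \tr (A *m Q *m A).
Proof.
move=> psdA symQ QQ.
have [trQ|trQ] := eqVneq (\tr Q) 0.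
  (* Division by zero makes the left side 0, and the right side is the trace of a Gram matrix. *)
  rewrite trQ invr0 mulr0 -QQ mulmxA -mulmxA.
  have -> : A *m Q = (Q *m A)^T by rewrite trmx_mul symQ psdA.1.
  exact: trace_sqr_ge0.
pose c := \tr (Q *m A) / \tr Q.
have := trace_sqr_ge0 (Q *m A - c *: Q).
rewrite [(_ - _)^T]linearB /= [(_ *: _)^T]linearZ /= trmx_mul symQ psdA.1.
rewrite mulmxBl !mulmxBr -!scalemxAl -!scalemxAr.
rewrite mulmxA -(mulmxA A Q Q) (mulmxA Q Q A) QQ !linearB /= !linearZ /=.
rewrite (mxtrace_mulC A Q) => h; rewrite -subr_ge0; apply: le_trans h _.
by rewrite le_eqVlt; apply/orP; left; apply/eqP; rewrite /c /GRing.scale /=; field.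
Qed.

End PositiveSemidefinite.

Section Residual.
Context {R : realType} {n : nat}.
Implicit Types (A Q : 'M[R]_n) (h : nat -> 'I_n).

Lemma psdmx_residual A h i : psdmx A -> psdmx (residual A h i).
Proof.
move=> psdA; elim: i => [//|i IHi] /=; case: eqP => // _; exact: psdmx_schur.
Qed.

Lemma residualS A h i : psdmx A ->
  residual A h i.+1 = schur (residual A h i) (h i).
Proof.
move=> psdA /=; case: eqP => // tr0.
rewrite (psdmx_tr_eq0 (psdmx_residual h i psdA) tr0) /schur.
by rewrite col0 mul0mx scaler0 subr0.
Qed.

Lemma psdmx_sub_residual A h i : psdmx A -> psdmx (A - residual A h i).
Proof.
move=> psdA; elim: i => [|i IHi]; first by rewrite subrr; exact: psdmx0.
rewrite residualS // -(subrKA (residual A h i)).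
exact/psdmxD/psdmx_sub_schur/psdmx_residual.
Qed.

Lemma eq_residual A h h' i : (forall j, (j < i)%N -> h j = h' j) ->
  residual A h i = residual A h' i.
Proof.
elim: i => [//|i IHi] hh' /=; rewrite IHi => [|j ji]; last exact/hh'/ltnW.
by rewrite (hh' i).
Qed.

Lemma residual_tr0 A h i m : psdmx A -> \tr (residual A h i) = 0 -> (i <= m)%N ->
  residual A h m = 0.
Proof.
move=> psdA tr0 /subnK <-; elim: (m - i)%N => [|j IHj].
  exact/psdmx_tr_eq0/tr0/psdmx_residual.
by rewrite addSn residualS // IHj /schur col0 mul0mx scaler0 subr0.
Qed.

End Residual.

(* The map f of the header; for k = 0 it is the identity, as x / 0 = 0. *)
Definition contraction {R : fieldType} (k mu a : R) : R := a - a ^+ 2 / (k * (a + mu)).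

(** The hypothesis on [1%:M - Q] bounds the denominator by [tr A <= tr (Q A) + mu]. With
    [trace_proj_sqr] for the numerator, the exact expectation becomes [contraction]. *)
Lemma expected_schur_le {R : realType} n (A Q : 'M[R]_n) (mu : R) :
  psdmx A -> Q^T = Q -> Q *m Q = Q -> \tr A != 0 -> 0 < mu ->
  \tr ((1%:M - Q) *m A) <= mu ->
  \sum_p A p p / \tr A * \tr (Q *m schur A p)
    <= contraction (\tr Q) mu (\tr (Q *m A)).
Proof.
move=> psdA symQ QQ trA mu_gt0 tail; rewrite expected_schur // lerD2l lerN2.
have trA_gt0 : 0 < \tr A by rewrite lt_def trA psdmx_tr_ge0.
have a_ge0 := trace_proj_ge0 psdA symQ QQ.
have trAle : \tr A <= \tr (Q *m A) + mu.
  by rewrite -lerBlDl -linearB /= -{1}[A]mul1mx -mulmxBl.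
have k_ge0 : 0 <= \tr Q by rewrite -QQ -{1}symQ trace_sqr_ge0.
apply: le_trans (ler_wpM2r _ (trace_proj_sqr psdA symQ QQ)); last first.
  by rewrite invr_ge0 ltW.
rewrite invfM mulrA ler_wpM2l //; first by rewrite mulr_ge0 ?invr_ge0 ?sqr_ge0.
by rewrite lef_pV2 // posrE; lra.
Qed.

(** * Concave contraction *)

Section Contraction.
Context {R : realType}.
Implicit Types (k mu a x : R).

Lemma contraction0 mu a : contraction 0 mu a = a.
Proof. by rewrite /contraction mul0r invr0 mulr0 subr0. Qed.

Lemma contraction_le k mu a : 0 <= k -> 0 < mu -> 0 <= a -> contraction k mu a <= a.
Proof.
move=> k0 mu0 a0; rewrite lerBlDr lerDl mulr_ge0 ?sqr_ge0 // invr_ge0.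
by rewrite mulr_ge0 // addr_ge0 // ltW.
Qed.

Lemma contraction_ge0 k mu a : 1 <= k -> 0 < mu -> 0 <= a -> 0 <= contraction k mu a.
Proof.
move=> k1 mu0 a0; have kam : 0 < k * (a + mu) by rewrite mulr_gt0; lra.
by rewrite subr_ge0 ler_pdivrMr // expr2 ler_wpM2l //; nra.
Qed.

(** Encodes nonnegative, concave, nondecreasing functions on the half-line by supporting lines of
    nonnegative slope. In this form the property passes to iterates and gives Jensen's inequality at
    once. *)
Definition supergradient (f : R -> R) : Prop :=
  forall x, 0 <= x -> 0 <= f x /\
    exists2 m, 0 <= m & forall a, 0 <= a -> f a <= f x + m * (a - x).

Lemma contraction_supergradient k mu : 1 <= k -> 0 < mu ->
  supergradient (contraction k mu).
Proof.
move=> k1 mu0 x x0; split; first exact: contraction_ge0.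
(* The slope is the derivative of the contraction at [x]; the gap to the tangent is the explicit
   nonnegative fraction below. *)
exists (1 - (1 - mu ^+ 2 / (x + mu) ^+ 2) / k) => [|a a0].
  rewrite subr_ge0 ler_pdivrMr; last lra.
  have : 0 <= mu ^+ 2 / (x + mu) ^+ 2 by rewrite mulr_ge0 ?invr_ge0 ?sqr_ge0.
  lra.
have [k0 am xm] : [/\ 0 < k, 0 < a + mu & 0 < x + mu] by split; lra.
rewrite -subr_ge0.
have -> : contraction k mu x + (1 - (1 - mu ^+ 2 / (x + mu) ^+ 2) / k) * (a - x)
    - contraction k mu a = mu ^+ 2 * (a - x) ^+ 2 / (k * (a + mu) * (x + mu) ^+ 2).
  rewrite /contraction; field.
  by rewrite !gt_eqF.
rewrite divr_ge0 ?(mulr_ge0 (sqr_ge0 _) (sqr_ge0 _)) // mulr_ge0 ?sqr_ge0 //.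
by rewrite mulr_ge0 // ltW.
Qed.

Lemma supergradient_iter f r : supergradient f -> supergradient (iter r f).
Proof.
move=> sf; elim: r => [|r IHr] x x0 /=.
  by split=> //; exists 1 => // a a0; lra.
have [fx0 [m m0 fm]] := IHr x x0; have [ffx0 [m' m'0 fm']] := sf _ fx0.
split=> //; exists (m' * m) => [|a a0]; first exact: mulr_ge0.
have [fa0 _] := IHr a a0; apply: le_trans (fm' _ fa0) _.
by rewrite lerD2l -mulrA ler_wpM2l // lerBlDl fm.
Qed.

(** Jensen's inequality: average the supporting line at [y]. Its nonnegative slope allows [y] to
    exceed the mean. *)
Lemma supergradient_mean (I : finType) f (w a : I -> R) y :
  supergradient f -> (forall i, 0 <= w i) -> \sum_i w i = 1 ->
  (forall i, 0 <= a i) -> 0 <= y -> \sum_i w i * a i <= y ->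
  \sum_i w i * f (a i) <= f y.
Proof.
move=> sf w0 w1 a0 y0 way; have [_ [m m0 fm]] := sf y y0.
apply: (@le_trans _ _ (\sum_i (w i * f y + m * (w i * a i) - w i * (m * y)))).
  apply: ler_sum => i _; have := ler_wpM2l (w0 i) (fm _ (a0 i)).
  by congr (_ <= _); ring.
rewrite sumrB big_split /= -!mulr_suml -mulr_sumr w1 !mul1r.
by rewrite lerBlDr lerD2l ler_wpM2l.
Qed.

(* The solution of x' = - x^2 / (k (x + mu)) satisfies k (potential mu x)' = -1;
   as potential mu is concave, the iterates of contraction decay at least as fast. *)
Definition potential mu x : R := ln (x / mu) + 1 - mu / x.

(** The decrease [1 / k] splits as [x / (k (x + mu)) + mu / (k (x + mu))]. The logarithm pays for
    the first summand by [ln (1 + h) <= h], and the term [- mu / x] for the second because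
    [y <= x]. *)
Lemma potential_contraction k mu x : 1 <= k -> 0 < mu -> 0 < x ->
  0 < contraction k mu x ->
  potential mu (contraction k mu x) <= potential mu x - k^-1.
Proof.
move=> k1 mu0 x0; set y := contraction k mu x => y0.
have yx : y <= x by apply: contraction_le => //; lra.
have [k0 xm] : 0 < k /\ 0 < x + mu by split; lra.
have lnyx : ln (y / mu) = ln (x / mu) + ln (y / x).
  rewrite -lnM ?posrE ?divr_gt0 //; congr ln; field.
  by rewrite !gt_eqF.
have : ln (y / x) <= - (x / (k * (x + mu))).
  have -> : y / x = 1 + - (x / (k * (x + mu))).
    by rewrite /y /contraction; field; rewrite !gt_eqF.
  rewrite le_ln1Dx // ltrN2 ltr_pdivrMr ?mulr_gt0 //; nra.
have : mu / x + mu / (k * (x + mu)) <= mu / y.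
  have -> : mu / y = mu / x + mu / (k * (x + mu)) * (x / y).
    have -> : mu / (k * (x + mu)) = mu * (x - y) / x ^+ 2.
      by rewrite /y /contraction; field; rewrite !gt_eqF.
    by field; rewrite !gt_eqF.
  rewrite lerD2l ler_peMr //; first by rewrite ltW // divr_gt0 // mulr_gt0.
  by rewrite ler_pdivlMr // mul1r.
have -> : k^-1 = x / (k * (x + mu)) + mu / (k * (x + mu)).
  by field; rewrite !gt_eqF.
rewrite /potential lnyx; lra.
Qed.

Lemma potential_iter k mu a r : 1 <= k -> 0 < mu -> 0 <= a ->
  mu < iter r (contraction k mu) a ->
  potential mu (iter r (contraction k mu) a) <= potential mu a - r%:R / k.
Proof.
move=> k1 mu0 a0; elim: r => [|r IHr] /=; first by rewrite mul0r subr0.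
set x := iter r _ a; move=> mux.
have x0 : 0 <= x.
  by have [] := supergradient_iter r (contraction_supergradient k1 mu0) a0.
have xle : contraction k mu x <= x by apply: contraction_le => //; lra.
(* The iterates do not increase, so exceeding [mu] passes back to the previous one. *)
have mulex : mu < x by exact: lt_le_trans xle.
have := potential_contraction k1 mu0 (lt_trans mu0 mulex) (lt_trans mu0 mux).
have := IHr mulex; rewrite -/x -[r.+1%:R]natr1 mulrDl mul1r; lra.
Qed.

(** If the last iterate exceeded [mu], its potential would be positive; but the potential of [a] is
    below [1 + ln (t / mu)], and [r] steps lower it by at least [r / k], to a negative number. For
    [k = 0] the contraction is the identity, whence the separate hypothesis. *)
Lemma iter_contraction_le (k r : nat) mu a t : 0 < mu -> 0 <= a -> a <= t ->
  (k = 0%N -> a <= mu) -> k%:R * (1 + ln (t / mu)) <= r%:R ->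
  iter r (contraction k%:R mu) a <= mu.
Proof.
move=> mu0 a0 at_ k0; case: k k0 => [k0 _|k _ rge].
  by elim: r => [|r IHr] /=; [exact: k0 | rewrite contraction0].
have k1 : 1 <= k.+1%:R :> R by rewrite ler1n.
have [//|mult] := leP.
have sg := contraction_supergradient k1 mu0.
have xa i : iter i (contraction k.+1%:R mu) a <= a.
  elim: i => [//|i IHi] /=; apply: le_trans IHi.
  by apply: contraction_le => //; have [] := supergradient_iter i sg a0.
have mua : mu < a := lt_le_trans mult (xa r).
have := potential_iter k1 mu0 a0 mult.
set x := iter r _ a in mult *; have x0 := lt_trans mu0 mult.
have lnx : 0 < ln (x / mu) by rewrite ln_gt0 // ltr_pdivlMr // mul1r.
have mux : mu / x < 1 by rewrite ltr_pdivrMr // mul1r.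
have mua0 : 0 < mu / a by rewrite divr_gt0 // (lt_trans mu0).
have lnat : ln (a / mu) <= ln (t / mu).
  by rewrite ler_ln ?posrE ?divr_gt0 ?ler_pM2r ?invr_gt0 //; lra.
have kr : 1 + ln (t / mu) <= r%:R / k.+1%:R.
  by rewrite ler_pdivlMr ?ltr0n // mulrC.
rewrite /potential; move: (_ / k.+1%:R) kr => c kr; lra.
Qed.

End Contraction.

(** * Spectral projectors and the tail rank *)

Section OrthogonalConjugation.
Context {R : realType} {n : nat}.
Implicit Types (U : 'M[R]_n) (x y : 'rV[R]_n).

(** For orthogonal [U] the eigenvectors are the rows of [U]; the i-th one, as a column, is
    [U^T *m delta_mx i 0]. *)
Definition conj_diag U x : 'M[R]_n := U^T *m diag_mx x *m U.

Lemma conj_diagE U x i j : conj_diag U x i j = \sum_l x 0 l * U l i * U l j.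
Proof.
rewrite /conj_diag mul_mx_diag mxE; apply: eq_bigr => l _; rewrite !mxE; ring.
Qed.

Lemma tr_conj_diag U x : (conj_diag U x)^T = conj_diag U x.
Proof. by rewrite !trmx_mul trmxK tr_diag_mx mulmxA. Qed.

Lemma conj_diagM U x y : U^T *m U = 1%:M ->
  conj_diag U x *m conj_diag U y = conj_diag U (\row_i (x 0 i * y 0 i)).
Proof.
move=> /mulmx1C UU; rewrite /conj_diag !mulmxA -(mulmxA _ U) UU mulmx1.
by rewrite -(mulmxA _ (diag_mx x)) mulmx_diag.
Qed.

Lemma conj_diag_const U a : U^T *m U = 1%:M -> conj_diag U (const_mx a) = a%:M.
Proof.
move=> UU; rewrite /conj_diag diag_const_mx -mulmxA mul_scalar_mx.
by rewrite -scalemxAr UU scalemx1.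
Qed.

Lemma mxtrace_conj_diag U x : U^T *m U = 1%:M -> \tr (conj_diag U x) = \sum_i x 0 i.
Proof.
by move=> /mulmx1C UU; rewrite mxtrace_mulC mulmxA UU mul1mx mxtrace_diag.
Qed.

Lemma bform_conj_diag U x v :
  bform (conj_diag U x) v v = \sum_i x 0 i * (U *m v) i 0 ^+ 2.
Proof. by rewrite -bform_mulmx bform_diag. Qed.

Lemma bform1_orthogonal U v : U^T *m U = 1%:M ->
  bform 1%:M v v = \sum_i (U *m v) i 0 ^+ 2.
Proof. by move=> UU; rewrite -bform1 bform_mulmx mulmx1 UU. Qed.

Lemma conj_diag_eigen U x i : U^T *m U = 1%:M ->
  bform (conj_diag U x) (U^T *m delta_mx i 0) (U^T *m delta_mx i 0) = x 0 i.
Proof.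
move=> /mulmx1C UU; rewrite bform_mulmx trmxK /conj_diag !mulmxA UU mul1mx.
by rewrite -mulmxA UU mulmx1 bform_delta mxE eqxx.
Qed.

Lemma conj_diag_inv U x : U^T *m U = 1%:M -> (forall i, x 0 i != 0) ->
  conj_diag U x \in unitmx /\
  invmx (conj_diag U x) = conj_diag U (\row_i (x 0 i)^-1).
Proof.
move=> UU x0.
have xV : conj_diag U x *m conj_diag U (\row_i (x 0 i)^-1) = 1%:M.
  rewrite conj_diagM // -(conj_diag_const 1 UU); congr conj_diag.
  by apply/rowP => i; rewrite !mxE divff.
have [xu _] := mulmx1_unit xV; split=> //.
by apply: (can_inj (mulKmx xu)); rewrite mulmxV.
Qed.

Lemma char_poly_conj_diag U x : U^T *m U = 1%:M ->
  char_poly (conj_diag U x) = \prod_i ('X - (x 0 i)%:P).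
Proof.
move=> UU.
have -> : char_poly (conj_diag U x) = char_poly (diag_mx x).
  rewrite /char_poly.
  have -> : char_poly_mx (conj_diag U x) =
      map_mx polyC U^T *m char_poly_mx (diag_mx x) *m map_mx polyC U.
    rewrite /char_poly_mx mulmxBr mulmxBl -!map_mxM /= mul_mx_scalar.
    by rewrite -scalemxAl -map_mxM UU map_mx1 scalemx1.
  rewrite !det_mulmx mulrC mulrA -det_mulmx -map_mxM.
  by rewrite (mulmx1C UU) map_mx1 det1 mul1r.
rewrite char_poly_trig ?diag_mx_is_trig //; apply: eq_bigr => i _.
by rewrite mxE eqxx.
Qed.

End OrthogonalConjugation.

(** Any diagonalization splits the characteristic polynomial into linear factors. Sorting its
    eigenvalues shows that the [xget] in [eigvals] finds a witness, and unique factorization makes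
    [eigvals A] a permutation of them, by which the rows of [U] are permuted. *)
Lemma eigvals_diagonalization {R : realType} n (A : 'M[R]_n) : A^T = A ->
  exists2 U, U^T *m U = 1%:M & A = conj_diag U (\row_i (eigvals A)`_i).
Proof.
move=> symA; have [U [d [UU AE]]] := symmetric_diagonalization symA.
have charA : char_poly A = \prod_(a <- [tuple d 0 i | i < n]) ('X - a%:P).
  rewrite {1}AE char_poly_conj_diag // big_tuple.
  by apply: eq_bigr => i _; rewrite tnth_mktuple.
have [_ eigA] : sorted >=%R (eigvals A) /\
    char_poly A = \prod_(a <- eigvals A) ('X - a%:P).
  apply: (@xgetPex _ [::] [set s : seq R | sorted >=%R s /\
                             char_poly A = \prod_(a <- s) ('X - a%:P)]).
  exists (sort >=%R [tuple d 0 i | i < n]); split.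
    by apply: sort_sorted => a b; exact: le_total.
  by rewrite charA; apply: perm_big; rewrite perm_sym perm_sort.
have /tuple_permP[p sE] : perm_eq (eigvals A) [tuple d 0 i | i < n].
  by apply: prod_XsubC_eq; rewrite -eigA.
have reindex_p (f : 'I_n -> R) : \sum_i f (p i) = \sum_i f i.
  by rewrite [RHS](reindex_inj (@perm_inj _ p)).
exists (row_perm p U).
  rewrite -UU; apply/matrixP => i j; rewrite !mxE -[RHS]reindex_p.
  by apply: eq_bigr => l _; rewrite !mxE.
rewrite {1}AE; apply/matrixP => i j; rewrite -[LHS]/(conj_diag U d i j) !conj_diagE.
rewrite -[LHS]reindex_p; apply: eq_bigr => l _; rewrite !mxE; congr (_ * _ * _).
by rewrite sE -[RHS](tnth_nth 0) tnth_map tnth_ord_tuple tnth_mktuple.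
Qed.

Lemma tail_projector {R : realType} n (A : 'M[R]_n) (k : nat) :
  A^T = A -> (k <= n)%N ->
  exists Q : 'M[R]_n, [/\ Q^T = Q, Q *m Q = Q, \tr Q = k%:R &
    \tr ((1%:M - Q) *m A) = \sum_(k <= i < n) (eigvals A)`_i].
Proof.
move=> symA kn; have [U UU AE] := eigvals_diagonalization symA.
(* Indicator of the first [k] indices, which belong to the largest eigenvalues as [eigvals] is
   nonincreasing. *)
pose e : 'rV[R]_n := \row_i (i < k)%:R.
exists (conj_diag U e); split.
- exact: tr_conj_diag.
- rewrite conj_diagM //; congr conj_diag; apply/rowP => i; rewrite !mxE.
  by rewrite -natrM mulnb andbb.
- rewrite mxtrace_conj_diag //; under eq_bigr do rewrite mxE.
  rewrite -natr_sum -(big_mkord xpredT (fun i => (i < k) : nat)) /=.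
  rewrite (big_cat_nat _ kn) //= [X in (_ + X)%N]big_nat_cond
    [X in (_ + X)%N]big1 => [|i]; last first.
    by move=> /andP[/andP[ki _] _]; rewrite ltnNge ki.
  rewrite addn0 (eq_big_nat _ _ (F2 := fun=> 1%N)) => [|i /andP[_ ->] //].
  by rewrite sum_nat_const_nat subn0 muln1.
- rewrite [X in (_ - _) *m X]AE mulmxBl mul1mx conj_diagM // linearB /=.
  rewrite !mxtrace_conj_diag //.
  rewrite -sumrB (eq_bigr (fun i : 'I_n => if (k <= i)%N then (eigvals A)`_i else 0)).
    rewrite -big_mkcond /= [RHS]big_nat_cond.
    rewrite [RHS](big_nat_widenl _ 0%N) // big_mkord.
    by apply: eq_bigl => i; rewrite ltn_ord !andbT andbb.
  move=> i _; rewrite !mxE (leqNgt k); case: (i < k)%N.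
    by rewrite mulr1n mul1r subrr.
  by rewrite mulr0n mul0r subr0.
Qed.

Lemma tail_rank_sum {R : realType} n (A : 'M[R]_n) mu : 0 <= mu ->
  (tail_rank mu A <= n)%N /\
  \sum_(tail_rank mu A <= i < n) (eigvals A)`_i <= mu.
Proof.
move=> mu0; rewrite /tail_rank; case: arg_minnP => [|k kmu _].
  by rewrite big_geq.
by split=> //; rewrite -ltnS ltn_ord.
Qed.

(** * Law of the residual trace *)

Section PivotProbability.
Context {R : realType} {d : measure_display} {T : measurableType d}.
Context (Pr : probability T R) {N : nat} (s : nat -> T -> 'I_N).
Implicit Types (h : nat -> 'I_N) (X : set T).

Definition history i h : set T := [set w | forall j, (j < i)%N -> s j w = h j].

Definition extend h i p : nat -> 'I_N := fun j => if j == i then p else h j.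

Lemma history_extend i h p :
  history i.+1 (extend h i p) = history i h `&` s i @^-1` [set p].
Proof.
apply/seteqP; split=> w /=.
  move=> hw; split=> [j ji|]; last by rewrite hw // /extend eqxx.
  by rewrite (hw _ (leqW ji)) /extend ltn_eqF.
move=> [hw sp] j; rewrite ltnS /extend leq_eqVlt.
by have [-> _|_ /= ji] := eqVneq j i; last exact: hw.
Qed.

Lemma history_split i h X :
  history i h `&` X = \big[setU/set0]_(p < N) (history i.+1 (extend h i p) `&` X).
Proof.
rewrite -bigcup_seq; apply/seteqP; split=> w /=.
  move=> [hw Xw]; exists (s i w); first by rewrite /= mem_index_enum.
  by rewrite history_extend.
by move=> [p _]; rewrite history_extend => -[[hw _] Xw].
Qed.

Lemma residual_extend (A : 'M[R]_N) h i p :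
  residual A (extend h i p) i = residual A h i.
Proof. by apply: eq_residual => j ji; rewrite /extend ltn_eqF. Qed.

Context (r : nat).
Hypothesis s_measurable : forall i p, (i < r)%N -> measurable (s i @^-1` [set p]).

Lemma measurable_history i h : (i <= r)%N -> measurable (history i h).
Proof.
elim: i => [_|i IHi ir].
  by rewrite (_ : history 0 h = setT) //; apply/seteqP; split.
have -> : history i.+1 h = history i h `&` s i @^-1` [set h i].
  rewrite -history_extend; apply/seteqP; split=> w hw j ji; rewrite hw // /extend;
  by case: eqVneq => // ->.
by apply: measurableI; [exact/IHi/ltnW | exact: s_measurable].
Qed.

(** Induction on the number [m] of pivots still free: splitting over the value of the next pivot
    ends in full histories, on which [P] is constant. *)
Lemma measurable_history_event (P : (nat -> 'I_N) -> Prop) i h : (i <= r)%N ->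
  (forall h h', (forall j, (j < r)%N -> h j = h' j) -> P h -> P h') ->
  measurable (history i h `&` [set w | P (s^~ w)]).
Proof.
move=> ir detP; have [m] : {m | i + m = r}%N by exists (r - i)%N; rewrite subnKC.
elim: m i h ir => [|m IHm] i h ir.
  rewrite addn0 => ir'; have [Ph|nPh] := pselect (P h).
    rewrite (_ : _ `&` _ = history i h); first exact: measurable_history.
    apply/seteqP; split=> w; first by case.
    by move=> hw; split=> //=; apply: detP Ph => j; rewrite -ir' => /hw ->.
  rewrite (_ : _ `&` _ = set0) //; apply/seteqP; split=> w //= [hw Pw].
  by apply/nPh/detP/Pw => j; rewrite -ir' => /hw.
rewrite addnS -addSn => imr; rewrite history_split.
apply: bigsetU_measurable => p _; apply: IHm => //.
by rewrite -imr leq_addr.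
Qed.

End PivotProbability.

(** Backward induction on the number [m] of steps left, joining Markov's inequality at the end of
    the run to Jensen's inequality at each step. The factor [Pr (history s i h)] stands for
    conditioning and keeps histories of probability zero harmless. *)
Lemma trace_residual_tail_prob {R : realType} {d : measure_display}
    {T : measurableType d} (Pr : probability T R) N (A Q : 'M[R]_N) r
    (s : nat -> T -> 'I_N) (mu c : R) i h :
  rpcholesky_pivots Pr A r s -> psdmx A -> Q^T = Q -> Q *m Q = Q -> 0 < mu -> 0 < c ->
  \tr ((1%:M - Q) *m A) <= mu -> supergradient (contraction (\tr Q) mu) ->
  (i <= r)%N ->
  (Pr (history s i h `&` [set w | (c <= \tr (residual A (s^~ w) r))%R])
    <= Pr (history s i h) *
       ((iter (r - i) (contraction (\tr Q) mu) (\tr (Q *m residual A h i))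
         + mu) / c)%:E)%E.
Proof.
move=> [sm sPr] psdA symQ QQ mu0 c0 tail sg ir.
set Bad := [set w | _].
have iter_ge0 m (B : 'M[R]_N) : psdmx B ->
    0 <= iter m (contraction (\tr Q) mu) (\tr (Q *m B)).
  by move=> psdB; have [] := supergradient_iter m sg (trace_proj_ge0 psdB symQ QQ).
have bound_ge0 m (B : 'M[R]_N) : psdmx B ->
    0 <= (iter m (contraction (\tr Q) mu) (\tr (Q *m B)) + mu) / c.
  by move=> psdB; rewrite divr_ge0 ?addr_ge0 ?iter_ge0 // ltW.
(* Every residual is dominated by [A] and inherits its tail bound. *)
have tailR j g : \tr ((1%:M - Q) *m residual A g j) <= mu.
  apply: le_trans tail; rewrite -subr_ge0 -linearB /= -mulmxBr.
  apply: trace_proj_ge0; first exact: psdmx_sub_residual.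
    by rewrite linearB /= trmx1 symQ.
  by rewrite mulmxBl mul1mx mulmxBr mulmx1 QQ subrr subr0.
have detBad (h1 h2 : nat -> 'I_N) : (forall j, (j < r)%N -> h1 j = h2 j) ->
    c <= \tr (residual A h1 r) -> c <= \tr (residual A h2 r).
  by move=> h12; rewrite (eq_residual A h12).
have [m imr] : {m | i + m = r}%N by exists (r - i)%N; rewrite subnKC.
have -> : (r - i = m)%N by rewrite -imr addKn.
elim: m i h ir imr => [|m IHm] i h ir imr.
  (* No pivot is left, so the history fixes the trace: either it is at least [c] and the factor on
     the right is at least 1, or the event is empty. *)
  rewrite /=; have [Ph|nPh] := leP c (\tr (residual A h r)).
    apply: (@le_trans _ _ (Pr (history s i h))).
      apply: le_measure; rewrite ?inE.
      - exact: (measurable_history_event (P := fun h => c <= \tr (residual A h r)) sm).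
      - exact: (measurable_history sm).
      - exact: subIsetl.
    rewrite lee_pemulr // lee_fin ler_pdivlMr // mul1r (le_trans Ph) //.
    rewrite -lerBlDl -linearB /= -{1}[residual A h r]mul1mx.
    by rewrite -imr addn0 -mulmxBl tailR.
  rewrite (_ : _ `&` _ = set0) ?measure0; last first.
    apply/seteqP; split=> w //= [hw].
    rewrite /Bad /= (_ : residual _ _ _ = residual A h r).
      by rewrite leNgt nPh.
    by apply: eq_residual => j; rewrite -imr addn0; exact: hw.
  rewrite mule_ge0 // lee_fin; exact: (bound_ge0 0%N _ (psdmx_residual h i psdA)).
have psdRi := psdmx_residual h i psdA.
(* At zero trace no law is prescribed, but the residual then stays 0, below [c]. *)
have [tr0|trN0] := eqVneq (\tr (residual A h i)) 0.
  rewrite (_ : _ `&` _ = set0) ?measure0.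
    by rewrite mule_ge0 // lee_fin bound_ge0.
  apply/seteqP; split=> w //= [hw]; rewrite /Bad /=.
  rewrite (residual_tr0 (i := i)) ?mxtrace0 //; first by rewrite leNgt c0.
  by rewrite -tr0; congr (\tr _); apply: eq_residual.
rewrite history_split measure_bigsetU_ord; last 2 first.
- move=> p; apply: (measurable_history_event
    (P := fun h => c <= \tr (residual A h r)) sm) => //.
  by rewrite -imr addnS -addSn leq_addr.
- move=> p q _ _ [w]; rewrite /= !history_extend.
  by move=> [[[_ /= <-] _] [[_ /= <-] _]].
have ir1 : (i < r)%N by rewrite -imr addnS -addSn leq_addr.
pose w p := residual A h i p p / \tr (residual A h i).
pose a p := \tr (Q *m schur (residual A h i) p).
have w_ge0 p : 0 <= w p.
  by rewrite divr_ge0 ?psdmx_diag_ge0 ?psdmx_tr_ge0.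
have w1 : \sum_p w p = 1 by rewrite -mulr_suml divff.
have a_ge0 p : 0 <= a p by apply: trace_proj_ge0 => //; exact: psdmx_schur.
have step p : (Pr (history s i.+1 (extend h i p) `&` Bad) <=
    Pr (history s i h) *
      (w p * ((iter m (contraction (\tr Q) mu) (a p) + mu) / c))%:E)%E.
  apply: le_trans (IHm i.+1 (extend h i p) ir1 _) _; first by rewrite addSn -addnS.
  rewrite residualS // residual_extend /extend eqxx -/(extend h i p) history_extend.
  by rewrite sPr // -muleA -EFinM.
apply: le_trans (lee_sum _ (fun p _ => step p)) _.
rewrite -ge0_sume_distrr; last first.
  move=> p _; rewrite lee_fin mulr_ge0 // divr_ge0 ?addr_ge0 // ?(ltW c0, ltW mu0) //.
  exact: (iter_ge0 m _ (psdmx_schur p psdRi)).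
(* [iterSr] detaches the innermost contraction, which accounts for the pivot drawn now. *)
rewrite iterSr lee_wpmul2l // sumEFin lee_fin.
under eq_bigr do rewrite mulrA.
rewrite -mulr_suml ler_pM2r ?invr_gt0 //.
under eq_bigr do rewrite mulrDr.
rewrite big_split /= -mulr_suml w1 mul1r lerD2r.
(* Jensen for the remaining [m] contractions; [expected_schur_le] bounds the mean over the next
   pivot. *)
apply: supergradient_mean => //.
- exact: supergradient_iter.
- by have [] := sg _ (trace_proj_ge0 psdRi symQ QQ).
- exact: expected_schur_le.
Qed.

(** After [r] steps the leading part contributes at most [mu] and the tail another [mu]; the
    threshold is this sum divided by [delta]. *)
Lemma residual_trace_prob {R : realType} {d : measure_display}
    {T : measurableType d} (Pr : probability T R) N (A : 'M[R]_N) r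
    (s : nat -> T -> 'I_N) (mu delta : R) :
  rpcholesky_pivots Pr A r s -> psdmx A -> 0 < mu -> 0 < delta ->
  (tail_rank mu A)%:R * (1 + ln (\tr A / mu)) <= r%:R ->
  (Pr [set w | (2 * mu / delta <= \tr (residual A (s^~ w) r))%R] <= delta%:E)%E.
Proof.
move=> pivots psdA mu0 delta0 rge; set Bad := [set w | _].
(* Even the empty history takes a dummy pivot sequence as argument, which a point of [T] provides;
   if [T] is empty, so is [Bad]. *)
have [N0|/contrapT[w0]] := pselect (~ inhabited T).
  rewrite (_ : Bad = set0) ?measure0 ?lee_fin ?ltW //.
  by apply/seteqP; split=> w // _; case: N0.
have [kN tail] := tail_rank_sum A (ltW mu0).
have [Q [symQ QQ trQ trQA]] := tail_projector psdA.1 kN.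
rewrite -trQA in tail.
have sg : supergradient (contraction (\tr Q) mu).
  (* Tail rank 0 is treated apart: the contraction is then the identity, and
     [contraction_supergradient] asks for [1 <= k]. *)
  rewrite trQ; case: (tail_rank mu A) => [|k]; last first.
    by apply: contraction_supergradient; rewrite ?ler1n.
  move=> x x0; rewrite contraction0; split=> //; exists 1 => // a a0.
  by rewrite contraction0; lra.
have c0 : 0 < 2 * mu / delta by rewrite divr_gt0 // mulr_gt0.
have := trace_residual_tail_prob (s^~ w0) pivots psdA symQ QQ mu0 c0 tail sg (leq0n r).
rewrite (_ : history s 0 _ = setT); last by apply/seteqP; split.
rewrite setTI probability_setT mul1e => /le_trans; apply; rewrite lee_fin.
rewrite ler_pdivrMr // subn0 /=.
have -> : delta * (2 * mu / delta) = mu + mu by field; rewrite gt_eqF.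
rewrite lerD2r trQ; apply: iter_contraction_le rge => //.
- exact: trace_proj_ge0.
- rewrite -subr_ge0 -linearB /= -{1}[A]mul1mx -mulmxBl; apply: trace_proj_ge0 => //.
    by rewrite linearB /= trmx1 symQ.
  by rewrite mulmxBl mul1mx mulmxBr mulmx1 QQ subrr subr0.
(* For tail rank 0, [Q] is positive semidefinite of trace 0, hence 0. *)
- move=> k0; have psdQ : psdmx Q.
    by rewrite -QQ -{1}symQ -(mulmx1 Q^T); exact/psdmx_conj/psdmx_scalar.
  by rewrite (psdmx_tr_eq0 psdQ) ?trQ ?k0 // mul0mx mxtrace0 ltW.
Qed.

(** * Condition number *)

Section SpectralNorm.
Context {R : realType} {n : nat}.
Implicit Types (A B M P : 'M[R]_n) (U : 'M[R]_n) (x : 'rV[R]_n) (v : 'cV[R]_n).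

Lemma psdmx_conj_diag U x : (forall i, 0 <= x 0 i) -> psdmx (conj_diag U x).
Proof.
move=> x0; split=> [|v]; first exact: tr_conj_diag.
rewrite -/(bform _ v v) bform_conj_diag sumr_ge0 // => i _.
by rewrite mulr_ge0 ?sqr_ge0.
Qed.

Lemma sqrtmxP P : psdmx P -> psdmx (sqrtmx P) /\ sqrtmx P *m sqrtmx P = P.
Proof.
move=> psdP; apply: (@xgetPex _ 0 [set S | psdmx S /\ S *m S = P]).
have [U [d [UU PE]]] := symmetric_diagonalization psdP.1.
have d0 i : 0 <= d 0 i by rewrite -(conj_diag_eigen d i UU) /conj_diag -PE psdmx_bform.
exists (conj_diag U (\row_i Num.sqrt (d 0 i))); split.
  by apply: psdmx_conj_diag => i; rewrite mxE sqrtr_ge0.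
rewrite conj_diagM // PE; congr conj_diag; apply/rowP => i.
by rewrite !mxE -expr2 sqr_sqrtr.
Qed.

Lemma bform_le_trace A v : psdmx A -> bform A v v <= \tr A * bform 1%:M v v.
Proof.
move=> psdA; have [U [d [UU AE]]] := symmetric_diagonalization psdA.1.
have d0 i : 0 <= d 0 i by rewrite -(conj_diag_eigen d i UU) /conj_diag -AE psdmx_bform.
rewrite {1 2}AE -/(conj_diag U d) mxtrace_conj_diag // bform_conj_diag.
rewrite (bform1_orthogonal v UU) mulr_suml; apply: ler_sum => i _.
rewrite ler_wpM2l // (bigD1 i) //= lerDl sumr_ge0 // => j _; exact: sqr_ge0.
Qed.

Lemma conj_diag_eigenvector U x i : U^T *m U = 1%:M ->
  conj_diag U x *m (U^T *m delta_mx i 0) = x 0 i *: (U^T *m delta_mx i (0 : 'I_1)).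
Proof.
move=> /mulmx1C UU; rewrite /conj_diag mulmxA -(mulmxA _ U) UU mulmx1 -mulmxA.
rewrite [RHS]scalemxAr; congr (_ *m _); apply/colP => j; rewrite mul_diag_mx !mxE.
by have [->|_] := eqVneq j i; rewrite ?mulr0.
Qed.

Lemma energy_conj_diag_le U x L v : U^T *m U = 1%:M -> 0 <= L ->
  (forall i, `|x 0 i| <= L) -> energy_norm 1%:M v <= 1 ->
  energy_norm 1%:M (conj_diag U x *m v) <= L.
Proof.
move=> UU L0 xL v1; rewrite /energy_norm -/(bform _ _ _) bform_mulmx mulmx1.
rewrite tr_conj_diag conj_diagM // bform_conj_diag.
have {}v1 : bform 1%:M v v <= 1.
  have := sqr_sqrtr (bform1_ge0 v); rewrite -[Num.sqrt _]/(energy_norm 1%:M v) => <-.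
  by rewrite expr_le1 // sqrtr_ge0.
have -> : L = Num.sqrt (L ^+ 2) by rewrite sqrtr_sqr ger0_norm.
rewrite ler_wsqrtr //; apply: (@le_trans _ _ (L ^+ 2 * bform 1%:M v v)).
  rewrite (bform1_orthogonal v UU) mulr_sumr; apply: ler_sum => i _.
  rewrite mxE -expr2 ler_wpM2r ?sqr_ge0 // -[_ ^+ 2]real_normK ?num_real //.
  by rewrite lerXn2r ?nnegrE.
by rewrite ler_piMr ?sqr_ge0.
Qed.

Lemma energy_norm0 M : energy_norm M 0 = 0.
Proof. by rewrite /energy_norm -/(bform M 0 0) bform0l sqrtr0. Qed.

Lemma spectral_norm_le U x L : U^T *m U = 1%:M -> 0 <= L ->
  (forall i, `|x 0 i| <= L) -> spectral_norm (conj_diag U x) <= L.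
Proof.
move=> UU L0 xL; apply: ge_sup.
  by exists (energy_norm 1%:M (conj_diag U x *m 0)), 0; rewrite //= energy_norm0.
by move=> _ [v /= v1 <-]; exact: energy_conj_diag_le.
Qed.

Lemma spectral_norm_ge0 M : 0 <= spectral_norm M.
Proof.
rewrite /spectral_norm; set X := [set _ | _ in _].
(* [sup] is 0 by default on a set without supremum. *)
have [supX|/sup_out -> //] := pselect (has_sup X).
apply: ub_le_sup; first exact: supX.2.
by exists 0; rewrite /= ?mulmx0 energy_norm0.
Qed.

Lemma le_spectral_norm U x i : U^T *m U = 1%:M ->
  `|x 0 i| <= spectral_norm (conj_diag U x).
Proof.
move=> UU; apply: ub_le_sup.
  (* The sum of the moduli bounds the set, so the supremum is genuine. *)
  exists (\sum_j `|x 0 j|) => _ [v /= v1 <-].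
  apply: energy_conj_diag_le => // [|j]; first exact: sumr_ge0.
  by rewrite (bigD1 j) //= lerDl sumr_ge0.
have UU' := mulmx1C UU.
exists (U^T *m delta_mx i 0) => /=.
  rewrite /energy_norm -/(bform _ _ _) bform_mulmx trmxK mulmx1 UU'.
  by rewrite bform_delta mxE eqxx sqrtr1.
rewrite conj_diag_eigenvector // /energy_norm -/(bform _ _ _) !bformE.
rewrite bform_mulmx trmxK mulmx1 UU' bform_delta mxE eqxx mulr1 -expr2.
by rewrite sqrtr_sqr.
Qed.

End SpectralNorm.

Section PositiveDefinite.
Context {R : realType} {n : nat}.

Definition posdefmx (M : 'M[R]_n) : Prop :=
  M^T = M /\ forall u, u != 0 -> 0 < bform M u u.

Lemma posdefmx_unit M : posdefmx M -> M \in unitmx.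
Proof.
move=> [symM M_gt0]; have [U [d [UU ME]]] := symmetric_diagonalization symM.
rewrite ME; have [|//] := @conj_diag_inv _ _ U d UU.
move=> i; rewrite -(conj_diag_eigen d i UU) /conj_diag -ME gt_eqF // M_gt0 //.
rewrite -bform1_eq0 bform_mulmx trmxK mulmx1 (mulmx1C UU) bform_delta mxE eqxx.
exact: oner_neq0.
Qed.

End PositiveDefinite.

Section Preconditioned.
Context {R : realType} {n : nat}.
Context (P : 'M[R]_n) (mu : R).
Hypotheses (mu_gt0 : 0 < mu) (psdPmu : psdmx (P - mu%:M)).

Lemma psdmx_preconditioner : psdmx P.
Proof.
rewrite -(subrK mu%:M P); apply: psdmxD => //; exact/psdmx_scalar/ltW.
Qed.

Lemma bform_preconditioner u : mu * bform 1%:M u u <= bform P u u.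
Proof.
have := psdmx_bform u psdPmu.
by rewrite bformDm bformNm bform_scalar subr_ge0.
Qed.

Lemma unitmx_preconditioner : P \in unitmx.
Proof.
apply: posdefmx_unit; split=> [|u u0]; first exact: psdmx_preconditioner.1.
apply: lt_le_trans (bform_preconditioner u); rewrite mulr_gt0 //.
by rewrite lt_def bform1_eq0 u0 bform1_ge0.
Qed.

Let S := sqrtmx P.
Let SS : S *m S = P := (sqrtmxP psdmx_preconditioner).2.
Let symS : S^T = S := (sqrtmxP psdmx_preconditioner).1.1.

Lemma unitmx_sqrtmx : S \in unitmx.
Proof. by have := unitmx_preconditioner; rewrite -SS unitmx_mul => /andP[]. Qed.

Definition preconditioned M := invmx S *m M *m invmx S.

Lemma tr_preconditioned M : M^T = M -> (preconditioned M)^T = preconditioned M.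
Proof. by move=> symM; rewrite !trmx_mul trmx_inv symS symM mulmxA. Qed.

Lemma bform_preconditioned M v :
  bform (preconditioned M) v v = bform M (invmx S *m v) (invmx S *m v).
Proof. by rewrite bform_mulmx trmx_inv symS. Qed.

Lemma bform_sqrtmx_inv v : bform P (invmx S *m v) (invmx S *m v) = bform 1%:M v v.
Proof.
rewrite bform_mulmx trmx_inv symS -SS !mulmxA mulVmx ?unitmx_sqrtmx //.
by rewrite mul1mx mulmxV ?unitmx_sqrtmx.
Qed.

(** In the Loewner order [P <= M <= L P], because [M - P <= tr (M - P) I] and [mu I <= P]. The
    substitution [u = S^-1 v] turns this into [1 <= b <= L] for the eigenvalues [b] of the
    preconditioned matrix. *)
Lemma condition_number_le M : psdmx (M - P) ->
  condition_number (preconditioned M) <= 1 + \tr (M - P) / mu.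
Proof.
move=> psdMP; set L := 1 + _.
have L1 : 1 <= L by rewrite lerDl divr_ge0 ?psdmx_tr_ge0 // ltW.
have symM : M^T = M.
  by rewrite -(subrK P M) linearD /= psdMP.1 psdmx_preconditioner.1.
have [V [b [VV BE]]] := symmetric_diagonalization (tr_preconditioned symM).
have bE i : b 0 i = bform M (invmx S *m (V^T *m delta_mx i 0))
                            (invmx S *m (V^T *m delta_mx i 0)).
  by rewrite -bform_preconditioned BE conj_diag_eigen.
have b_bounds i : 1 <= b 0 i <= L.
  have e1 : bform 1%:M (V^T *m delta_mx i 0) (V^T *m delta_mx i 0) = 1.
    by rewrite bform_mulmx trmxK mulmx1 (mulmx1C VV) bform_delta mxE eqxx.
  rewrite bE -(subrK P M) bformDm bform_sqrtmx_inv e1.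
  set u := invmx S *m _; rewrite lerDr psdmx_bform //= /L addrC lerD2l.
  apply: le_trans (bform_le_trace u psdMP) _.
  rewrite ler_wpM2l ?psdmx_tr_ge0 // -div1r ler_pdivlMr // mulrC.
  by apply: le_trans (bform_preconditioner u) _; rewrite bform_sqrtmx_inv e1.
have b_gt0 i : 0 < b 0 i by have /andP[b1 _] := b_bounds i; exact: lt_le_trans b1.
have [_ BV] := @conj_diag_inv _ _ V b VV (fun i => lt0r_neq0 (b_gt0 i)).
rewrite /condition_number BE BV.
have normB : spectral_norm (conj_diag V b) <= L.
  apply: spectral_norm_le => // [|i]; first lra.
  by rewrite gtr0_norm //; have /andP[] := b_bounds i.
have normBV : spectral_norm (conj_diag V (\row_i (b 0 i)^-1)) <= 1.
  apply: spectral_norm_le => // i; rewrite mxE gtr0_norm ?invr_gt0 //.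
  by rewrite invf_le1 //; have /andP[] := b_bounds i.
rewrite -[L]mulr1 ler_pM ?spectral_norm_ge0 //.
Qed.

(** The condition number bounds only the ratio of the extreme eigenvalues, so the scale [a] is
    existential: it is the reciprocal of the norm of the inverse, a norm that is positive because
    [0 < n]. *)
Lemma condition_number_eigen M K : posdefmx M ->
  condition_number (preconditioned M) <= K -> (0 < n)%N ->
  exists V b a, [/\ V^T *m V = 1%:M, preconditioned M = conj_diag V b, 0 < a &
    forall i, a <= b 0 i <= a * K].
Proof.
move=> [symM M_gt0] condK n0.
have [V [b [VV BE]]] := symmetric_diagonalization (tr_preconditioned symM).
have b_gt0 i : 0 < b 0 i.
  rewrite -(conj_diag_eigen b i VV) /conj_diag -BE bform_preconditioned M_gt0 //.
  apply/eqP => h; have := bform_sqrtmx_inv (V^T *m delta_mx i 0).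
  rewrite h bform0l bform_mulmx trmxK mulmx1 (mulmx1C VV) bform_delta mxE eqxx.
  by move/eqP; rewrite eq_sym oner_eq0.
have [_ BV] := @conj_diag_inv _ _ V b VV (fun i => lt0r_neq0 (b_gt0 i)).
move: condK; rewrite /condition_number BE BV.
set nB := spectral_norm _; set nBV := spectral_norm _ => condK.
have bV_le i : (b 0 i)^-1 <= nBV.
  have := le_spectral_norm (\row_i (b 0 i)^-1) i VV.
  by rewrite mxE gtr0_norm ?invr_gt0.
have nBV0 : 0 < nBV by apply: lt_le_trans (bV_le (Ordinal n0)); rewrite invr_gt0.
exists V, b, nBV^-1; split=> // [|i]; first by rewrite invr_gt0.
rewrite -[X in _ <= X <= _]invrK lef_pV2 ?posrE ?invr_gt0 // bV_le /=.
rewrite invrK ler_pdivlMl // mulrC; apply: le_trans condK; rewrite ler_pM2r //.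
by apply: le_trans (le_spectral_norm b i VV); rewrite gtr0_norm.
Qed.

End Preconditioned.

(** * Preconditioned conjugate gradient *)

(** The Chebyshev polynomial T_t; writing the argument as [(z + z^-1) / 2] gives access to its
    growth outside [-1, 1]. *)
Lemma chebyshev_poly {R : realFieldType} t :
  exists2 p : {poly R}, (size p <= t.+1)%N &
    (forall x, `|x| <= 1 -> `|p.[x]| <= 1) /\
    (forall z, z != 0 -> p.[(z + z^-1) / 2] = (z ^+ t + z ^- t) / 2).
Proof.
(* Recursion on the pair (T_t, U_{t-1}), tracking Pell's equation
   T_t^2 - (X^2 - 1) U_{t-1}^2 = 1. *)
suff [p [u [sp _ pell pE _]]] : exists p u : {poly R},
    [/\ (size p <= t.+1)%N, (size u <= t)%N,
        forall x, p.[x] ^+ 2 - (x ^+ 2 - 1) * u.[x] ^+ 2 = 1,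
        forall z, z != 0 -> p.[(z + z^-1) / 2] = (z ^+ t + z ^- t) / 2 &
        forall z, z != 0 ->
          u.[(z + z^-1) / 2] * ((z - z^-1) / 2) = (z ^+ t - z ^- t) / 2].
  exists p => //; split=> // x x1.
  rewrite -(expr_le1 (n := 2)) // real_normK ?num_real //.
  have : 0 <= (1 - x ^+ 2) * u.[x] ^+ 2.
    rewrite mulr_ge0 ?sqr_ge0 // subr_ge0 -[x ^+ 2]real_normK ?num_real //.
    by rewrite expr_le1.
  have := pell x; lra.
have hE := (hornerD, hornerN, hornerM, hornerX, hornerXn, hornerC).
elim: t => [|t [p [u [sp su pell pE uE]]]].
  exists 1, 0; split=> [|||z z0|z z0]; rewrite ?size_poly1 ?size_poly0 //.
  - by move=> x; rewrite hornerC horner0; ring.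
  - by rewrite hornerC expr0; field.
  - by rewrite horner0 expr0; field.
(* With [z = e^theta] these are the addition formulas for cosh and sinh of [(t + 1) theta]. *)
exists ('X * p + ('X ^+ 2 - 1) * u), ('X * u + p); split.
- rewrite (leq_trans (size_polyD _ _)) // geq_max; apply/andP; split.
    by rewrite (leq_trans (size_polyMleq _ _)) // size_polyX.
  rewrite (leq_trans (size_polyMleq _ _)) // size_XnsubC //.
- rewrite (leq_trans (size_polyD _ _)) // geq_max sp andbT.
  by rewrite (leq_trans (size_polyMleq _ _)) // size_polyX.
- by move=> x; rewrite !hE -[RHS](pell x); ring.
- move=> z z0; rewrite !hE pE // exprS.
  have -> : (((z + z^-1) / 2) ^+ 2 - 1) * u.[(z + z^-1) / 2] =
      (z - z^-1) / 2 * ((z ^+ t - z ^- t) / 2) by rewrite -uE //; field.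
  by field; rewrite z0 expf_neq0.
- move=> z z0; rewrite !hE mulrDl -mulrA uE // pE // exprS; field.
  by rewrite z0 expf_neq0.
Qed.

(** The scaled Chebyshev polynomial [p (l x) / p g]: the affine map [l] sends [[a, a K]] onto
    [-1, 1] and 0 to [g]. *)
Lemma krylov_poly {R : rcfType} (a K : R) t : 0 < a -> 1 < K ->
  exists2 q : {poly R}, (size q <= t.+1)%N /\ q.[0] = 1 &
    forall x, a <= x <= a * K ->
      `|q.[x]| <= 2 * ((Num.sqrt K - 1) / (Num.sqrt K + 1)) ^+ t.
Proof.
move=> a0 K1; have [p sp [p_le1 pE]] := @chebyshev_poly R t.
pose k := Num.sqrt K; have k1 : 1 < k by rewrite -sqrtr1 ltr_sqrt //; lra.
have kk : k ^+ 2 = K by rewrite sqr_sqrtr //; lra.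
(* Chosen so that [(z + z^-1) / 2 = (K + 1) / (K - 1)], the image of 0 under [l]; there [p] is at
   least [z ^+ t / 2]. *)
pose z := (k + 1) / (k - 1).
have z0 : 0 < z by rewrite divr_gt0; lra.
pose g := (z + z^-1) / 2.
have gE : g = (K + 1) / (K - 1).
  rewrite /g /z -kk; field; rewrite !gt_eqF //; nra.
have pg : z ^+ t / 2 <= p.[g].
  rewrite pE ?gt_eqF // ler_pM2r ?invr_gt0 // lerDl invr_ge0 exprn_ge0 //.
  exact: ltW.
have zt0 : 0 < z ^+ t by rewrite exprn_gt0.
have pg0 : 0 < p.[g] by apply: lt_le_trans pg; rewrite divr_gt0.
pose l : {poly R} := g%:P - (2 / (a * (K - 1))) *: 'X.
have lE x : l.[x] = g - 2 / (a * (K - 1)) * x by rewrite /l !hornerE.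
exists (p.[g]^-1 *: (p \Po l)).
  split.
    have sl : (size l <= 2)%N.
      rewrite (leq_trans (size_polyD _ _)) // geq_max size_polyN.
      rewrite (leq_trans (size_polyC_leq1 _)) //= (leq_trans (size_scale_leq _ _)) //.
      by rewrite size_polyX.
    rewrite (leq_trans (size_scale_leq _ _)) // (leq_trans (size_comp_poly_leq _ _)) //.
    rewrite ltnS -[t]muln1 leq_mul //; first by case: (size p) sp.
    by case: (size l) sl.
  by rewrite hornerZ horner_comp lE mulr0 subr0 mulVf // gt_eqF.
move=> x /andP[ax xaK]; rewrite hornerZ horner_comp normrM.
have -> : (k - 1) / (k + 1) = z^-1 by rewrite /z invf_div.
rewrite gtr0_norm ?invr_gt0 //.
have pl : `|p.[l.[x]]| <= 1.
  apply: p_le1; rewrite lE gE.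
  have -> : (K + 1) / (K - 1) - 2 / (a * (K - 1)) * x =
      (a * (K + 1) - 2 * x) / (a * (K - 1)).
    by field; rewrite !gt_eqF //; lra.
  have aK : 0 < a * (K - 1) by rewrite mulr_gt0 //; lra.
  by rewrite ler_norml ler_pdivlMr // ler_pdivrMr //; apply/andP; split; lra.
apply: le_trans (_ : p.[g]^-1 * 1 <= _); first by rewrite ler_wpM2l // invr_ge0 ltW.
rewrite mulr1 exprVn -[X in X * _]invrK -invfM lef_pV2 ?posrE ?mulr_gt0 ?invr_gt0 //.
by rewrite mulrC.
Qed.

Section ConjugateGradient.
Context {R : realType} {n : nat}.
Implicit Types (M P : 'M[R]_n) (u v w z b y : 'cV[R]_n) (X : seq 'cV[R]_n).

(** Gram-Schmidt for the inner product of [M], by induction on the generators: [x'] is, up to sign,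
    the part of [x] orthogonal to the other generators, and corrects [w] along the new direction. *)
Lemma orthogonal_projection M X z : posdefmx M ->
  exists2 w, w \in <<X>>%VS & forall u, u \in <<X>>%VS -> bform M (w - z) u = 0.
Proof.
move=> [symM M_gt0]; elim: X z => [|x X IHX] z.
  exists 0; first exact: mem0v.
  by move=> u; rewrite span_nil memv0 => /eqP ->; rewrite bform0r.
have [w wX wz] := IHX z; have [px pxX pxx] := IHX x.
pose x' := px - x; pose c := bform M (w - z) x' / bform M x' x'.
have cE : bform M (w - z) x' - c * bform M x' x' = 0.
  have [x'0|x'0] := eqVneq x' 0; first by rewrite x'0 !bform0r mulr0 subrr.
  by rewrite /c mulfVK ?subrr // gt_eqF // M_gt0.
have x'X : x' \in <<x :: X>>%VS.
  rewrite span_cons memvB //; first exact: (subvP (addvSr _ _)).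
  by apply: (subvP (addvSl _ _)); exact: memv_line.
exists (w - c *: x').
  rewrite memvB ?memvZ //; rewrite span_cons; exact: (subvP (addvSr _ _)).
move=> u; rewrite span_cons => /memv_addP[_ /vlineP[e ->] [v vX ->]].
have -> : w - c *: x' - z = (w - z) - c *: x' by rewrite addrAC.
have -> : e *: x + v = (e *: px + v) - e *: x'.
  by rewrite /x' scalerBr opprB [RHS]addrC addrA subrK.
have pvX : e *: px + v \in <<X>>%VS by rewrite memvD ?memvZ.
rewrite bformDr bformNr bformZr !(bformDl _ _ (- (c *: x'))) !bformNl !bformZl.
by rewrite wz // /x' pxx // mulr0 subr0 add0r -/x' cE mulr0 oppr0.
Qed.

(** The iterate has its defining property once a minimizer exists; the [M]-orthogonal projection of
    the solution is one, by Pythagoras. *)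
Lemma pcg_iterate_min M P b t u : posdefmx M -> u \in krylov M P b t ->
  energy_norm M (pcg_iterate M P b t - invmx M *m b)
    <= energy_norm M (u - invmx M *m b).
Proof.
move=> pdM uK; set z := invmx M *m b.
have [_ h] : pcg_iterate M P b t \in krylov M P b t /\
    forall u, u \in krylov M P b t ->
      energy_norm M (pcg_iterate M P b t - z) <= energy_norm M (u - z).
  apply: (@xgetPex _ 0 [set w | w \in krylov M P b t /\
    forall u, u \in krylov M P b t ->
      energy_norm M (w - invmx M *m b) <= energy_norm M (u - invmx M *m b)]).
  have [w wK wz] := orthogonal_projection
    [seq (invmx P *m M) ^+ j *m (invmx P *m b) | j <- iota 0 t] z pdM.
  exists w; split=> // v vK; rewrite /energy_norm -!/(bform _ _ _) -/z.
  rewrite ler_wsqrtr //.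
  have -> : v - z = (w - z) + (v - w) by rewrite [RHS]addrC subrKA.
  have vwK : v - w \in krylov M P b t by rewrite memvB.
  move: (wz _ vwK); move: (v - w) (w - z) => e f fe.
  rewrite !bformDl !bformDr (bformC e f) ?pdM.1 // fe addr0 add0r lerDl.
  have [->|e0] := eqVneq e 0; first by rewrite bform0l.
  exact/ltW/pdM.2.
exact: h.
Qed.

(** By minimality a single Krylov vector suffices. Its error is [- q(C) z] with [C = P^-1 M],
    estimated in the coordinates [W = V S], where [C] is diagonal with entries [b] and the squared
    energy norm is a sum of squares weighted by [b]. *)
Lemma pcg_iterate_le M P mu K y t :
  0 < mu -> psdmx (P - mu%:M) -> posdefmx M -> (0 < n)%N -> 1 < K ->
  condition_number (preconditioned P M) <= K ->
  energy_norm M (pcg_iterate M P y t - invmx M *m y)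
    <= 2 * ((Num.sqrt K - 1) / (Num.sqrt K + 1)) ^+ t * energy_norm M (invmx M *m y).
Proof.
move=> mu0 psdPmu pdM n0 K1 condK.
have [V [b [a [VV BE a0 ab]]]] := condition_number_eigen mu0 psdPmu pdM condK n0.
have [q [sq q0] q_le] := krylov_poly t a0 K1.
set S := sqrtmx P in BE; have Su : S \in unitmx := unitmx_sqrtmx mu0 psdPmu.
have [psdS SS] := sqrtmxP (psdmx_preconditioner mu0 psdPmu).
pose W := V *m S.
have ME v : bform M v v = \sum_i b 0 i * (W *m v) i 0 ^+ 2.
  rewrite -{1 2}(mulKmx Su v) -(bform_preconditioned mu0 psdPmu) BE bform_conj_diag.
  by under eq_bigr do rewrite mulmxA.
pose C := invmx P *m M.
have WC : W *m C = diag_mx b *m W.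
  have -> : C = invmx S *m preconditioned P M *m S.
    have Pu := unitmx_preconditioner mu0 psdPmu.
    rewrite /preconditioned -/S !mulmxA mulmxKV // /C; apply: (can_inj (mulKmx Pu)).
    by rewrite mulKVmx // -[in RHS]SS -!mulmxA !mulKVmx.
  rewrite BE /W /conj_diag !mulmxA mulmxK // (mulmx1C VV) mul1mx //.
pose z := invmx M *m y.
have Cz : C *m z = invmx P *m y.
  by rewrite /C /z -mulmxA mulKVmx // posdefmx_unit.
have WCz i j : (W *m (C ^+ j *m z)) i 0 = b 0 i ^+ j * (W *m z) i 0.
  elim: j => [|j IHj]; first by rewrite !expr0 mul1mx mul1r.
  rewrite !exprS -[C * _]/(C *m _) -(mulmxA C) (mulmxA W) WC -(mulmxA _ W).
  by rewrite mul_diag_mx mxE IHj mulrA.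
(* This is [(1 - q(C)) z]: since [q] has constant term 1, only powers [C^(j+1) z] occur, and
   [C z = P^-1 y] places them in the Krylov space. *)
pose u := \sum_(j < t) - q`_j.+1 *: (C ^+ j *m (invmx P *m y)).
have uK : u \in krylov M P y t.
  apply: memv_suml => j _; apply/memvZ/memv_span/mapP.
  by exists (j : nat) => //; rewrite mem_iota add0n ltn_ord.
apply: le_trans (pcg_iterate_min pdM uK) _; rewrite -/z.
set eta := 2 * _.
have Wu i : (W *m (u - z)) i 0 = - q.[b 0 i] * (W *m z) i 0.
  have -> : q.[b 0 i] = 1 + \sum_(j < t) q`_j.+1 * b 0 i ^+ j.+1.
    rewrite (horner_coef_wide _ sq) big_ord_recl expr0 mulr1 -horner_coef0 q0.
    by congr (_ + _); apply: eq_bigr => j _; rewrite lift0.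
  rewrite mulmxBr mulmx_sumr [LHS]mxE summxE [X in _ + X]mxE opprD mulrBl mulN1r addrC.
  congr (_ + _); rewrite mulr_suml -sumrN; apply: eq_bigr => j _.
  rewrite -scalemxAr mxE -Cz (mulmxA (C ^+ j)) -[C ^+ j *m C]/(C ^+ j * C).
  by rewrite -exprSr WCz mulNr mulrA.
have eta0 : 0 <= eta.
  have /andP[ab0 ba0] := ab (Ordinal n0).
  by apply: le_trans (q_le (b 0 (Ordinal n0)) _) => //; rewrite ab0.
rewrite /energy_norm -!/(bform _ _ _) !ME.
have -> : eta = Num.sqrt (eta ^+ 2) by rewrite sqrtr_sqr ger0_norm.
rewrite -sqrtrM ?sqr_ge0 // ler_wsqrtr // mulr_sumr; apply: ler_sum => i _.
have b0 : 0 <= b 0 i by have /andP[ai _] := ab i; exact: le_trans (ltW a0) ai.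
rewrite Wu exprMn sqrrN mulrCA ler_wpM2r //; first by rewrite mulr_ge0 ?sqr_ge0.
by rewrite -[_ ^+ 2]real_normK ?num_real // lerXn2r ?nnegrE // q_le.
Qed.

End ConjugateGradient.

(** * Exponential form of the convergence rate *)

Section ExponentialRate.
Import numFieldNormedType.Exports.

(** The function [f] vanishes at 0 and has derivative [y (e^y - e^-y) >= 0], so [f x >= 0] by the
    mean value theorem; divide by [(1 + x) e^x]. *)
Lemma ratio_le_expR {R : realType} (x : R) : 0 <= x ->
  (1 - x) / (1 + x) <= expR (- (2 * x)).
Proof.
rewrite le_eqVlt => /orP[/eqP <-|x0]; first by rewrite mulr0 oppr0 expR0 !addr0 divr1.
pose f (y : R) := (1 + y) * expR (- y) - (1 - y) * expR y.
have df y : is_derive y (1 : R) f (y * (expR y - expR (- y))).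
  apply: is_derive_eq; rewrite /GRing.scale /=; ring.
have cf : {within `[0, x], continuous f}.
  apply: continuous_subspaceT => y; apply/differentiable_continuous/derivable1_diffP.
  by have [] := df y.
have [c] := MVT x0 (fun y _ => df y) cf; rewrite in_itv /= => /andP[c0 cx].
rewrite [f 0]/f oppr0 expR0 !(addr0, subr0) subrr subr0 => fxE.
have : 0 <= f x.
  rewrite fxE !mulr_ge0 ?(ltW x0) ?(ltW c0) // subr_ge0 ler_expR.
  by lra.
rewrite /f subr_ge0 => fx.
rewrite ler_pdivrMr; last lra.
rewrite (_ : - (2 * x) = - x + - x); last by ring.
rewrite expRD -mulrA mulrC -ler_pdivrMr ?expR_gt0 //.
by rewrite -expRN opprK [expR _ * _]mulrC.
Qed.

End ExponentialRate.

(** For [k = sqrt (3 / delta)], [k sqrt delta = sqrt 3 <= 2], so [2 / k >= sqrt delta] and each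
    iteration gains a factor [expR (- sqrt delta)]. *)
Lemma convergence_rate {R : realType} (delta epsilon : R) t :
  0 < delta < 1 -> 0 < epsilon < 1 ->
  delta `^ (- (1 / 2)) * ln (2 / epsilon) <= t%:R ->
  2 * ((Num.sqrt (3 / delta) - 1) / (Num.sqrt (3 / delta) + 1)) ^+ t <= epsilon.
Proof.
move=> /andP[d0 d1] /andP[e0 e1]; rewrite powRN div1r powR12_sqrt ?(ltW d0) //.
set sd := Num.sqrt delta; have sd0 : 0 < sd by rewrite sqrtr_gt0.
rewrite ler_pdivrMl // => tge.
pose k := Num.sqrt (3 / delta); rewrite -/k.
have k1 : 1 < k.
  by rewrite -sqrtr1 ltr_sqrt ?divr_gt0 // ltr_pdivlMr // mul1r; lra.
have ksd : (k * sd) ^+ 2 = 3.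
  rewrite exprMn !sqr_sqrtr ?divr_ge0 ?ltW //; field; exact: lt0r_neq0.
have k0 : 0 < k by lra.
have ksd2 : sd <= 2 * k^-1.
  rewrite ler_pdivlMr // mulrC; have : 0 <= k * sd by rewrite mulr_ge0 ?ltW.
  by nra.
have ratioE : (k - 1) / (k + 1) = (1 - k^-1) / (1 + k^-1).
  by field; rewrite !gt_eqF //; lra.
have /lerXn2r : (k - 1) / (k + 1) <= expR (- sd).
  rewrite ratioE; apply: le_trans (ratio_le_expR _) _; first by rewrite invr_ge0 ltW.
  by rewrite ler_expR lerN2.
rewrite !nnegrE divr_ge0 ?expR_ge0; [|lra..].
move=> /(_ t isT isT) h; rewrite mulrC -ler_pdivlMr //; apply: le_trans h _.
rewrite -expRM_natr mulNr -(lnK (x := epsilon / 2)) ?posrE ?divr_gt0 // ler_expR.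
by rewrite -invf_div lnV ?posrE ?divr_gt0 // lerN2.
Qed.

Theorem theorem1 (R : realType) (delta epsilon : R)
    (delta01 : 0 < delta < 1) (epsilon01 : 0 < epsilon < 1)
    (N : nat) (A : 'M[R]_N) (psdA : psdmx A) (mu : R) (mu_gt0 : 0 < mu)
    (r : nat)
    (r_ge : (tail_rank mu A)%:R * (1 + ln (\tr A / mu)) <= r%:R)
    (d : measure_display) (T : measurableType d) (Pr : probability T R)
    (s : nat -> T -> 'I_N) (s_pivots : rpcholesky_pivots Pr A r s) :
  let P := fun w : T => rpcholesky A (fun i => s i w) r + mu%:M in
  let good := [set w : T |
    condition_number (invmx (sqrtmx (P w)) *m (A + mu%:M)
                        *m invmx (sqrtmx (P w))) <= 3 / delta] in
  ((1 - delta)%:E <= Pr good)%E /\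
  forall w, good w ->
    forall (y : 'cV[R]_N) (t : nat),
      delta `^ (- (1 / 2)) * ln (2 / epsilon) <= t%:R ->
      let beta := invmx (A + mu%:M) *m y in
      energy_norm (A + mu%:M) (pcg_iterate (A + mu%:M) (P w) y t - beta)
        <= epsilon * energy_norm (A + mu%:M) beta.
Proof.
move=> P good; have [/andP[d0 d1] /andP[e0 e1]] := (delta01, epsilon01).
have K1 : 1 < 3 / delta by rewrite ltr_pdivlMr // mul1r; lra.
have psdP h : psdmx (rpcholesky A h r + mu%:M - mu%:M).
  by rewrite addrK; exact: psdmx_sub_residual.
have MPE h : A + mu%:M - (rpcholesky A h r + mu%:M) = residual A h r.
  by rewrite opprD addrACA subrr addr0 /rpcholesky subKr.
have pdM : posdefmx (A + mu%:M).
  split=> [|u u0]; first by rewrite linearD /= psdA.1 tr_scalar_mx.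
  rewrite bformDm bform_scalar ltr_wpDl ?psdmx_bform // mulr_gt0 //.
  by rewrite lt_def bform1_ge0 bform1_eq0 u0.
split; last first.
  move=> w goodw y t tge /=.
  (* The pivot [s 0 w] is an index below [N]. *)
  have N0 : (0 < N)%N by case: (N) (s 0%N w) => // -[].
  apply: le_trans (pcg_iterate_le y t mu_gt0 (psdP _) pdM N0 K1 goodw) _.
  by apply: ler_wpM2r; [exact: sqrtr_ge0 | exact: convergence_rate].
(* A probability space is nonempty; its point supplies the dummy pivot sequence of the empty
   history. *)
have [N0|/contrapT[w0]] := pselect (~ inhabited T).
  have := probability_setT Pr; rewrite (_ : setT = set0).
    by rewrite measure0 => /eqP; rewrite eqe eq_sym oner_eq0.
  by apply/seteqP; split=> w // _; case: N0.
have history0 : history s 0 (s^~ w0) = setT by apply/seteqP; split.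
pose bad := [set w | 2 * mu / delta <= \tr (residual A (s^~ w) r)].
have mbad : measurable bad.
  have bad_det (h h' : nat -> 'I_N) : (forall j, (j < r)%N -> h j = h' j) ->
      2 * mu / delta <= \tr (residual A h r) -> 2 * mu / delta <= \tr (residual A h' r).
    by move=> hh'; rewrite (eq_residual A hh').
  have := measurable_history_event s_pivots.1 (s^~ w0) (leq0n r) bad_det.
  by rewrite history0 setTI.
(* [good] depends only on the first [r] pivots. *)
have mgood : measurable good.
  pose accurate h := condition_number
    (preconditioned (rpcholesky A h r + mu%:M) (A + mu%:M)) <= 3 / delta.
  have accurate_det h h' : (forall j, (j < r)%N -> h j = h' j) ->
      accurate h -> accurate h'.
    by move=> hh'; rewrite /accurate /rpcholesky (eq_residual A hh').
  have := measurable_history_event s_pivots.1 (s^~ w0) (leq0n r) accurate_det.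
  by rewrite history0 setTI.
have bad_le := residual_trace_prob s_pivots psdA mu_gt0 d0 r_ge.
apply: (@le_trans _ _ (Pr (~` bad))).
  by rewrite probability_setC // EFinB leeB.
apply: le_measure; rewrite ?inE //; first exact: measurableC.
move=> w /= /negP; rewrite -ltNge => small.
apply: le_trans (condition_number_le mu_gt0 (psdP _) _) _; rewrite MPE.
  exact: psdmx_residual.
(* Source of the 3: off [bad], [1 + tr R_r / mu < 1 + 2 / delta], and [1 <= 1 / delta]. *)
have -> : 3 / delta = 1 / delta + 2 * mu / delta / mu.
  by field; rewrite !gt_eqF.
rewrite lerD ?ler_pdivlMr //; first lra.
by rewrite mulfVK ?gt_eqF // -ler_pdivlMr // ltW.
Qed.
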